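(* Let $H$ be a quasitriangular Hopf algebra over a field $\Bbbk$ with universal R-matrix $R$, let $C,B$ be weakly dual Hopf algebras in $\mathcal{B}=H\text{-}\mathbf{Mod}$, and let $A$ be a right $C$-comodule algebra in $\mathcal{B}$. Then $A\rtimes B\rtimes H$ is a left $\mathrm{Drin}_H(C,B)$-comodule algebra (with $A\rtimes B$ as a comodule subalgebra), where the left $B$-module structure on $A$ is obtained from the right $C$-comodule structure $\delta_A$ via $(\mathrm{Id}_A\otimes\mathrm{ev})(\delta_A\otimes\mathrm{Id}_B)\Psi_{B,A}(S\otimes\mathrm{Id}_A)\colon B\otimes A\to A$. The coaction $\delta_{\mathrm{Drin}}$ is given by $$\delta_{\mathrm{Drin}}(a)=R^{-(1)}a^{(-1)}\otimes (R^{-(2)}\triangleright a^{(0)}),\qquad \delta_{\mathrm{Drin}}(b)=b_{(1)}R^{(2)}\otimes (R^{(1)}\triangleright b_{(2)}),\qquad \delta_{\mathrm{Drin}}(h)=h_{(1)}\otimes h_{(2)},$$ for $a\in A$, $b\in B$, $h\in H$, where $\delta_A(a)=a^{(0)}\otimes a^{(-1)}\in A\otimes C$ denotes the right $C$-coaction on $A$.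
   Context: Conventions: Sweedler notation with implicit sums; $R=R^{(1)}\otimes R^{(2)}\in H\otimes H$ is the universal R-matrix, with inverse $R^{-1}=R^{-(1)}\otimes R^{-(2)}$, satisfying ${R^{(1)}}_{(1)}\otimes {R^{(1)}}_{(2)}\otimes R^{(2)}=R_1^{(1)}\otimes R_2^{(1)}\otimes R_1^{(2)}R_2^{(2)}$, $R^{(1)}\otimes {R^{(2)}}_{(1)}\otimes {R^{(2)}}_{(2)}=R_1^{(1)}R_2^{(1)}\otimes R_2^{(2)}\otimes R_1^{(2)}$ (subscripts $1,2$ on $R$ denote different copies of $R$), and $R^{(1)}h_{(1)}\otimes R^{(2)}h_{(2)}=h_{(2)}R^{(1)}\otimes h_{(1)}R^{(2)}$ for $h\in H$. All Hopf algebras have invertible antipode. $H\text{-}\mathbf{Mod}$ denotes left $H$-modules (action written $\triangleright$), braided by $\Psi_{V,W}(v\otimes w)=(R^{(2)}\triangleright w)\otimes(R^{(1)}\triangleright v)$. Hopf algebras in $\mathcal{B}$: algebra and coalgebra structures in $\mathcal{B}$ with $\Delta m=(m\otimes m)(\mathrm{Id}\otimes\Psi\otimes\mathrm{Id})(\Delta\otimes\Delta)$, $\Delta$ and $\varepsilon$ unital, $\varepsilon$ multiplicative, together with an antipode $S$ in $\mathcal{B}$ (two-sided convolution inverse of the identity). $b_{(1)}\otimes b_{(2)}$, $c_{(1)}\otimes c_{(2)}$ denote the coproducts in $\mathcal{B}$ of $B$, $C$. Weakly dual Hopf algebras $C,B$: there is a morphism $\mathrm{ev}\colon C\otimes B\to\Bbbk$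 in $\mathcal{B}$ (not necessarily non-degenerate) with $\mathrm{ev}(cc',b)=\mathrm{ev}(c,b_{(2)})\mathrm{ev}(c',b_{(1)})$, $\mathrm{ev}(c,bb')=\mathrm{ev}(c_{(2)},b)\mathrm{ev}(c_{(1)},b')$, $\mathrm{ev}(1,b)=\varepsilon(b)$, $\mathrm{ev}(c,1)=\varepsilon(c)$, $\mathrm{ev}(Sc,b)=\mathrm{ev}(c,Sb)$. $\mathrm{Drin}_H(C,B)$ (braided Drinfeld double) is the $\Bbbk$-bialgebra (here a Hopf algebra) generated by $C,H,B$ as subalgebras with relations, for $b\in B,c\in C,h\in H$, $$(R^{-(1)}\triangleright b_{(2)})(R^{-(2)}\triangleright c_{(1)})\,\mathrm{ev}(c_{(2)},b_{(1)})=R^{-(1)}c_{(2)}b_{(1)}R^{(2)}\,\mathrm{ev}(R^{-(2)}\triangleright c_{(1)},R^{(1)}\triangleright b_{(2)}),$$ $hb=(h_{(1)}\triangleright b)h_{(2)}$, $hc=(h_{(1)}\triangleright c)h_{(2)}$, and coproduct $\Delta(h)=h_{(1)}\otimes h_{(2)}$, $\Delta(b)=b_{(1)}R^{(2)}\otimes(R^{(1)}\triangleright b_{(2)})$, $\Delta(c)=R^{-(1)}c_{(2)}\otimes(R^{-(2)}\triangleright c_{(1)})$; the counit is the multiplicative extension of the counits of $C,H,B$. A right $C$-comodule algebra $A$ in $\mathcal{B}$ is an algebra in $\mathcal{B}$ with a right $C$-coaction $\delta_A\colon A\to A\otimes C$ in $\mathcal{B}$ satisfying $\delta_A m_A=(m_A\otimes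 m_C)(\mathrm{Id}_A\otimes\Psi_{C,A}\otimes\mathrm{Id}_C)(\delta_A\otimes\delta_A)$ and $\delta_A 1_A=1_A\otimes 1_C$. $A\rtimes B\rtimes H$ is the algebra on the vector space $A\otimes B\otimes H$ with $A$, $B$, $H$ as subalgebras and relations $$ba=(R^{(2)}\triangleright a)^{(0)}(R^{(1)}\triangleright b)_{(2)}\,\mathrm{ev}\big((R^{(2)}\triangleright a)^{(-1)},S((R^{(1)}\triangleright b)_{(1)})\big),\quad ha=(h_{(1)}\triangleright a)h_{(2)},\quad hb=(h_{(1)}\triangleright b)h_{(2)};$$ $A\rtimes B$ is the subalgebra $A\otimes B$. *)

(* Defs.v *)
From HB Require Import structures.
From mathcomp Require Import all_boot all_algebra.
From mathcomp Require Import boolp.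

Set Implicit Arguments.
Unset Strict Implicit.
Unset Printing Implicit Defensive.

Import GRing.Theory.
Local Open Scope ring_scope.
Local Open Scope quotient_scope.

(* Associative unital algebras, the zero algebra included: MathComp's [algType]
   requires 1 != 0. *)
HB.mixin Record Lmodule_isPzAlgebra (k : pzRingType) A
    of GRing.Lmodule k A := {
  algmul : A -> A -> A;
  algone : A;
  algmulA : associative algmul;
  algmul1l : left_id algone algmul;
  algmul1r : right_id algone algmul;
  algmulDl : left_distributive algmul +%R;
  algmulDr : right_distributive algmul +%R;
  algscaleAl : forall (x : k) u v, x *: algmul u v = algmul (x *: u) v;
  algscaleAr : forall (x : k) u v, x *: algmul u v = algmul u (x *: v)
}.
#[short(type="pzAlgType")]
HB.structure Definition PzAlgebra (k : pzRingType) :=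
  {A of GRing.Lmodule k A & Lmodule_isPzAlgebra k A}.

HB.instance Definition _ (k : pzRingType) (A : pzAlgType k) :=
  GRing.Zmodule_isPzRing.Build A (@algmulA k A) (@algmul1l k A) (@algmul1r k A)
    (@algmulDl k A) (@algmulDr k A).

(* Tensor product over k: formal sums of pairs, two of them being identified
   when no bilinear map separates them. *)
Section Tensor.
Variables (k : fieldType) (V W : lmodType k).

Definition tensor_rel (s t : seq (V * W)) : bool :=
  `[< forall (U : lmodType k) (f : {bilinear V -> W -> U}),
        \sum_(p <- s) f p.1 p.2 = \sum_(p <- t) f p.1 p.2 >].

Lemma tensor_rel_refl : reflexive tensor_rel.
Proof. by move=> s; apply/asboolP. Qed.
Lemma tensor_rel_sym : symmetric tensor_rel.
Proof. by move=> s t; apply/asboolP/asboolP => st U f; rewrite st. Qed.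
Lemma tensor_rel_trans : transitive tensor_rel.
Proof.
move=> t s u /asboolP st /asboolP tu; apply/asboolP => U f.
by rewrite st tu.
Qed.

Canonical tensor_equiv :=
  EquivRel tensor_rel tensor_rel_refl tensor_rel_sym tensor_rel_trans.

Definition tensor := {eq_quot tensor_rel}.
HB.instance Definition _ := Choice.on tensor.

Definition tens (v : V) (w : W) : tensor := \pi_tensor [:: (v, w)].
Definition tensor_zero : tensor := \pi_tensor [::].
Definition tensor_add (t u : tensor) : tensor := \pi_tensor (repr t ++ repr u).
Definition tensor_scale (a : k) (t : tensor) : tensor :=
  \pi_tensor [seq (a *: p.1, p.2) | p <- repr t].

(* Sweedler sums: [\sw_(x , y <- t) F x y] is the sum of the F x_i y_i for a
   decomposition t = \sum_i x_i (x) y_i. It does not depend on the chosen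
   decomposition when F is bilinear; see [sweedler_pi] and [sweedlerT]. *)
Definition sweedler (U : nmodType) (t : tensor) (F : V -> W -> U) : U :=
  \sum_(p <- repr t) F p.1 p.2.

Lemma tensor_eqP (s t : seq (V * W)) :
  \pi_tensor s = \pi_tensor t <->
  forall (U : lmodType k) (f : {bilinear V -> W -> U}),
    \sum_(p <- s) f p.1 p.2 = \sum_(p <- t) f p.1 p.2.
Proof.
split=> [/eqP|st]; first by rewrite eqmodE => /asboolP.
by apply/eqP; rewrite eqmodE; apply/asboolP.
Qed.

Lemma sweedler_pi (U : lmodType k) (f : {bilinear V -> W -> U}) s :
  sweedler (\pi_tensor s) f = \sum_(p <- s) f p.1 p.2.
Proof. by rewrite /sweedler; apply: (tensor_eqP _ _).1; rewrite reprK. Qed.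

Lemma tensor_extP (t u : tensor) :
  (forall (U : lmodType k) (f : {bilinear V -> W -> U}),
     sweedler t f = sweedler u f) -> t = u.
Proof. by move=> tu; rewrite -[t]reprK -[u]reprK; apply/tensor_eqP. Qed.

Lemma sweedler_add (U : lmodType k) (f : {bilinear V -> W -> U}) t u :
  sweedler (tensor_add t u) f = sweedler t f + sweedler u f.
Proof. by rewrite sweedler_pi big_cat. Qed.

Lemma sweedler_zero (U : lmodType k) (f : {bilinear V -> W -> U}) :
  sweedler tensor_zero f = 0.
Proof. by rewrite sweedler_pi big_nil. Qed.

Lemma sweedler_scale (U : lmodType k) (f : {bilinear V -> W -> U}) a t :
  sweedler (tensor_scale a t) f = a *: sweedler t f.
Proof.
rewrite sweedler_pi big_map scaler_sumr; apply: eq_bigr => p _ /=.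
by rewrite linearZl_LR.
Qed.

Fact tensor_addA : associative tensor_add.
Proof. by move=> t u v; apply: tensor_extP => U f; rewrite !sweedler_add addrA. Qed.
Fact tensor_addC : commutative tensor_add.
Proof. by move=> t u; apply: tensor_extP => U f; rewrite !sweedler_add addrC. Qed.
Fact tensor_add0 : left_id tensor_zero tensor_add.
Proof.
by move=> t; apply: tensor_extP => U f; rewrite sweedler_add sweedler_zero add0r.
Qed.
Fact tensor_addN : left_inverse tensor_zero (tensor_scale (-1)) tensor_add.
Proof.
move=> t; apply: tensor_extP => U f.
by rewrite sweedler_add sweedler_scale sweedler_zero scaleN1r addNr.
Qed.

HB.instance Definition _ := GRing.isZmodule.Build tensor
  tensor_addA tensor_addC tensor_add0 tensor_addN.

Fact tensor_scaleA a b t :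
  tensor_scale a (tensor_scale b t) = tensor_scale (a * b) t.
Proof. by apply: tensor_extP => U f; rewrite !sweedler_scale scalerA. Qed.
Fact tensor_scale1 : left_id 1 tensor_scale.
Proof. by move=> t; apply: tensor_extP => U f; rewrite sweedler_scale scale1r. Qed.
Fact tensor_scaleDr : right_distributive tensor_scale +%R.
Proof.
move=> a t u; apply: tensor_extP => U f.
by rewrite sweedler_scale !sweedler_add !sweedler_scale scalerDr.
Qed.
Fact tensor_scaleDl t : {morph tensor_scale^~ t : a b / a + b}.
Proof.
move=> a b; apply: tensor_extP => U f.
by rewrite sweedler_add !sweedler_scale scalerDl.
Qed.

HB.instance Definition _ := GRing.Zmodule_isLmodule.Build k tensor
  tensor_scaleA tensor_scale1 tensor_scaleDr tensor_scaleDl.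

Fact tens_is_bilinear : bilinear_for *:%R *:%R tens.
Proof.
split=> [w a v v'|v a w w']; apply: tensor_extP => U f;
  rewrite sweedler_add sweedler_scale /tens !sweedler_pi !big_seq1 /=.
- by rewrite linearPl.
- by rewrite linearPr.
Qed.
HB.instance Definition _ :=
  bilinear_isBilinear.Build k V W tensor *:%R *:%R tens tens_is_bilinear.

Lemma sweedler_tens (U : lmodType k) (f : {bilinear V -> W -> U}) v w :
  sweedler (tens v w) f = f v w.
Proof. by rewrite sweedler_pi big_seq1. Qed.

Definition tensor_lift (U : lmodType k) (f : {bilinear V -> W -> U})
  (t : tensor) : U := sweedler t f.
Fact tensor_lift_linear (U : lmodType k) (f : {bilinear V -> W -> U}) :
  linear (tensor_lift f).
Proof.
by move=> a t u; rewrite /tensor_lift sweedler_add sweedler_scale.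
Qed.
HB.instance Definition _ (U : lmodType k) (f : {bilinear V -> W -> U}) :=
  GRing.isLinear.Build k tensor U *:%R (tensor_lift f) (tensor_lift_linear f).

Lemma tensorE (t : tensor) : t = sweedler t tens.
Proof.
apply: tensor_extP => U f; rewrite -[RHS]/(tensor_lift f _) {2}/sweedler.
rewrite raddf_sum; apply: eq_bigr => p _.
exact: esym (sweedler_tens f p.1 p.2).
Qed.

Lemma tensor_lift_unique (U : lmodType k) (g h : {linear tensor -> U}) :
  (forall v w, g (tens v w) = h (tens v w)) -> g =1 h.
Proof.
move=> gh t; rewrite [t]tensorE /sweedler !raddf_sum.
by apply: eq_bigr => p _; apply: gh.
Qed.

Lemma tensor_ind (P : tensor -> Prop) :
  P 0 -> (forall v w t, P t -> P (tens v w + t)) -> forall t, P t.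
Proof.
move=> P0 PD t; rewrite [t]tensorE /sweedler /=.
elim: (repr t) => [|p s IHs]; rewrite ?big_nil ?big_cons //.
exact: PD.
Qed.

(* The same for unbundled bilinear maps. *)
Section SweedlerFor.
Variables (U : lmodType k) (F : V -> W -> U).
Hypothesis bilF : bilinear_for *:%R *:%R F.
#[local] HB.instance Definition _ :=
  bilinear_isBilinear.Build k V W U *:%R *:%R F bilF.

Lemma sweedlerT v w : sweedler (tens v w) F = F v w.
Proof. exact: (sweedler_tens F). Qed.
Lemma sweedlerP a t u :
  sweedler (a *: t + u) F = a *: sweedler t F + sweedler u F.
Proof. exact: (tensor_lift_linear F). Qed.
Lemma sweedlerD t u : sweedler (t + u) F = sweedler t F + sweedler u F.
Proof. exact: (sweedler_add F). Qed.
Lemma sweedlerZ a t : sweedler (a *: t) F = a *: sweedler t F.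
Proof. exact: (sweedler_scale F). Qed.
Lemma sweedler0 : sweedler 0 F = 0.
Proof. exact: (sweedler_zero F). Qed.

End SweedlerFor.

Lemma sweedlerPr (U : lmodType k) (t : tensor) a (F G : V -> W -> U) :
  sweedler t (fun v w => a *: F v w + G v w) = a *: sweedler t F + sweedler t G.
Proof. by rewrite /sweedler big_split scaler_sumr. Qed.

End Tensor.

Notation "V ⊗ W" := (tensor V W) (at level 40, left associativity) : type_scope.
Notation "v ⊠ w" := (tens v w) (at level 40, left associativity) : ring_scope.
Notation "\sw_ ( x , y <- t ) F" := (sweedler t (fun x y => F))
  (at level 41, x name, y name, t at level 99, F at level 41,
   format "\sw_ ( x ,  y  <-  t )  F") : ring_scope.

Section TensorAlgebra.
Variables (k : fieldType) (A B : pzAlgType k).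

Definition tensor_mul (t u : A ⊗ B) : A ⊗ B :=
  \sw_(a, b <- t) \sw_(a', b' <- u) (a * a') ⊠ (b * b').
Definition tensor_one : A ⊗ B := (1 : A) ⊠ (1 : B).

Fact tensor_mul_bil1 (a : A) (b : B) :
  bilinear_for *:%R *:%R (fun (a' : A) (b' : B) => (a * a') ⊠ (b * b') : A ⊗ B).
Proof.
split=> [b' x u v|a' x u v] /=.
  by rewrite mulrDr -[a * (x *: u)]algscaleAr linearPl.
by rewrite mulrDr -[b * (x *: u)]algscaleAr linearPr.
Qed.

Fact tensor_mul_bil2 (u : A ⊗ B) : bilinear_for *:%R *:%R
  (fun (a : A) (b : B) => \sw_(a', b' <- u) (a * a') ⊠ (b * b') : A ⊗ B).
Proof.
split=> [b x a1 a2|a x b1 b2] /=; rewrite -sweedlerPr;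
  apply: eq_bigr => p _.
  by rewrite mulrDl -[(x *: a1) * _]algscaleAl linearPl.
by rewrite mulrDl -[(x *: b1) * _]algscaleAl linearPr.
Qed.

Lemma tensor_mulT (a : A) (b : B) (a' : A) (b' : B) :
  tensor_mul (a ⊠ b) (a' ⊠ b') = (a * a') ⊠ (b * b').
Proof.
rewrite /tensor_mul (sweedlerT (tensor_mul_bil2 _)).
exact: (sweedlerT (tensor_mul_bil1 a b)).
Qed.

Fact tensor_mulPl x : forall t u v,
  tensor_mul (x *: t + u) v = x *: tensor_mul t v + tensor_mul u v.
Proof. by move=> t u v; rewrite /tensor_mul (sweedlerP (tensor_mul_bil2 v)). Qed.
Fact tensor_mulPr x : forall t u v,
  tensor_mul t (x *: u + v) = x *: tensor_mul t u + tensor_mul t v.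
Proof.
move=> t u v; rewrite /tensor_mul -sweedlerPr; apply: eq_bigr => p _.
exact: (sweedlerP (tensor_mul_bil1 p.1 p.2)).
Qed.
Fact tensor_mulDl : left_distributive tensor_mul +%R.
Proof. by move=> t u v; rewrite -[t in LHS]scale1r tensor_mulPl scale1r. Qed.
Fact tensor_mulDr : right_distributive tensor_mul +%R.
Proof. by move=> t u v; rewrite -[u in LHS]scale1r tensor_mulPr scale1r. Qed.
Fact tensor_mul0l u : tensor_mul 0 u = 0.
Proof. by apply: (@addIr _ (tensor_mul 0 u)); rewrite -tensor_mulDl !add0r. Qed.
Fact tensor_mul0r u : tensor_mul u 0 = 0.
Proof. by apply: (@addIr _ (tensor_mul u 0)); rewrite -tensor_mulDr !add0r. Qed.
Fact tensor_scaleAl x t u : x *: tensor_mul t u = tensor_mul (x *: t) u.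
Proof. by rewrite -[x *: t]addr0 tensor_mulPl tensor_mul0l addr0. Qed.
Fact tensor_scaleAr x t u : x *: tensor_mul t u = tensor_mul t (x *: u).
Proof. by rewrite -[x *: u]addr0 tensor_mulPr tensor_mul0r addr0. Qed.

Fact tensor_mulA : associative tensor_mul.
Proof.
elim/tensor_ind=> [|a b t IHt] u v; first by rewrite !tensor_mul0l.
rewrite !tensor_mulDl -IHt {IHt}; congr (_ + _).
elim/tensor_ind: u => [|a' b' u IHu]; first by rewrite !(tensor_mul0l, tensor_mul0r).
rewrite !(tensor_mulDl, tensor_mulDr) -IHu {IHu}; congr (_ + _).
elim/tensor_ind: v => [|a'' b'' v IHv]; first by rewrite !tensor_mul0r.
by rewrite !tensor_mulDr IHv !tensor_mulT !mulrA.
Qed.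
Fact tensor_mul1l : left_id tensor_one tensor_mul.
Proof.
elim/tensor_ind=> [|a b t IHt]; first by rewrite tensor_mul0r.
by rewrite tensor_mulDr IHt tensor_mulT !mul1r.
Qed.
Fact tensor_mul1r : right_id tensor_one tensor_mul.
Proof.
elim/tensor_ind=> [|a b t IHt]; first by rewrite tensor_mul0l.
by rewrite tensor_mulDl IHt tensor_mulT !mulr1.
Qed.

HB.instance Definition _ := Lmodule_isPzAlgebra.Build k (tensor A B)
  tensor_mulA tensor_mul1l tensor_mul1r tensor_mulDl tensor_mulDr
  tensor_scaleAl tensor_scaleAr.
HB.instance Definition _ := GRing.PzRing.copy (tensor A B)
  (PzAlgebra.sort (tensor A B)).

End TensorAlgebra.

Lemma tensor_mulE (k : fieldType) (A B : pzAlgType k) (t u : A ⊗ B) :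
  t * u = \sw_(a, b <- t) \sw_(a', b' <- u) (a * a') ⊠ (b * b').
Proof. by []. Qed.
Lemma tensor_oneE (k : fieldType) (A B : pzAlgType k) : 1 = (1 : A) ⊠ (1 : B) :> A ⊗ B.
Proof. by []. Qed.


Section Bialgebras.
Variable k : fieldType.

Record is_coalgebra (C : lmodType k) (Delta : {linear C -> C ⊗ C})
    (eps : {scalar C}) : Prop := {
  coalg_coassoc : forall c,
    \sw_(x, y <- Delta c) \sw_(x1, x2 <- Delta x) x1 ⊠ (x2 ⊠ y) =
    \sw_(x, y <- Delta c) \sw_(y1, y2 <- Delta y) x ⊠ (y1 ⊠ y2);
  coalg_counitl : forall c, \sw_(x, y <- Delta c) eps x *: y = c;
  coalg_counitr : forall c, \sw_(x, y <- Delta c) eps y *: x = c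
}.

Record is_bialgebra (H : pzAlgType k) (Delta : {linear H -> H ⊗ H})
    (eps : {scalar H}) : Prop := {
  bialg_coalgebra : is_coalgebra Delta eps;
  bialg_DeltaM : monoid_morphism Delta;
  bialg_epsM : monoid_morphism eps
}.

Record is_antipode (H : pzAlgType k) (Delta : {linear H -> H ⊗ H})
    (eps : {scalar H}) (S : {linear H -> H}) : Prop := {
  antipode_l : forall h, \sw_(x, y <- Delta h) S x * y = eps h *: (1 : H);
  antipode_r : forall h, \sw_(x, y <- Delta h) x * S y = eps h *: (1 : H)
}.

Record qtHopf := QTHopf {
  qt_alg :> pzAlgType k;
  qt_Delta : {linear qt_alg -> qt_alg ⊗ qt_alg};
  qt_eps : {scalar qt_alg};
  qt_S : {linear qt_alg -> qt_alg};
  qt_bialgebra : is_bialgebra qt_Delta qt_eps;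
  qt_antipode : is_antipode qt_Delta qt_eps qt_S;
  qt_S_bij : bijective qt_S;
  qt_R : qt_alg ⊗ qt_alg;
  qt_Rinv : qt_alg ⊗ qt_alg;
  qt_mulRRinv : qt_R * qt_Rinv = 1;
  qt_mulRinvR : qt_Rinv * qt_R = 1;
  qt_hexagonl :
    \sw_(r, s <- qt_R) \sw_(r1, r2 <- qt_Delta r) r1 ⊠ (r2 ⊠ s) =
    \sw_(r, s <- qt_R) \sw_(r', s' <- qt_R) r ⊠ (r' ⊠ (s * s'));
  qt_hexagonr :
    \sw_(r, s <- qt_R) \sw_(s1, s2 <- qt_Delta s) r ⊠ (s1 ⊠ s2) =
    \sw_(r, s <- qt_R) \sw_(r', s' <- qt_R) (r * r') ⊠ (s' ⊠ s);
  qt_quasicocomm : forall h : qt_alg,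
    \sw_(r, s <- qt_R) \sw_(h1, h2 <- qt_Delta h) (r * h1) ⊠ (s * h2) =
    \sw_(r, s <- qt_R) \sw_(h1, h2 <- qt_Delta h) (h2 * r) ⊠ (h1 * s)
}.

End Bialgebras.


Section Category.
Variables (k : fieldType) (H : qtHopf k).
Local Notation DeltaH := (@qt_Delta k H).
Local Notation epsH := (@qt_eps k H).
Local Notation R := (@qt_R k H).

Record is_module (V : lmodType k) (act : {bilinear H -> V -> V}) : Prop := {
  module_act1 : forall v, act 1 v = v;
  module_actM : forall g h v, act (g * h) v = act g (act h v)
}.

Record is_module_algebra (A : pzAlgType k) (act : {bilinear H -> A -> A})
    : Prop := {
  modalg_module : is_module act;
  modalg_actM : forall h a b,
    act h (a * b) = \sw_(h1, h2 <- DeltaH h) act h1 a * act h2 b;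
  modalg_act1 : forall h, act h 1 = epsH h *: (1 : A)
}.

(* Psi_{V,W}(v (x) w) *)
Definition braiding (V W : lmodType k) (actV : {bilinear H -> V -> V})
    (actW : {bilinear H -> W -> W}) (v : V) (w : W) : W ⊗ V :=
  \sw_(r, s <- R) actW s w ⊠ actV r v.

Record brHopf := BrHopf {
  br_alg :> pzAlgType k;
  br_act : {bilinear H -> br_alg -> br_alg};
  br_Delta : {linear br_alg -> br_alg ⊗ br_alg};
  br_eps : {scalar br_alg};
  br_S : {linear br_alg -> br_alg};
  br_module_algebra : is_module_algebra br_act;
  br_coalgebra : is_coalgebra br_Delta br_eps;
  br_act_Delta : forall h b, br_Delta (br_act h b) =
    \sw_(h1, h2 <- DeltaH h) \sw_(b1, b2 <- br_Delta b)
      br_act h1 b1 ⊠ br_act h2 b2;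
  br_act_eps : forall h b, br_eps (br_act h b) = epsH h * br_eps b;
  br_act_S : forall h b, br_S (br_act h b) = br_act h (br_S b);
  br_DeltaM : forall b b', br_Delta (b * b') =
    \sw_(b1, b2 <- br_Delta b) \sw_(b1', b2' <- br_Delta b')
      \sw_(x, y <- braiding br_act br_act b2 b1') (b1 * x) ⊠ (y * b2');
  br_Delta1 : br_Delta 1 = 1;
  br_epsM : monoid_morphism br_eps;
  br_antipode : is_antipode br_Delta br_eps br_S;
  br_S_bij : bijective br_S
}.

Local Notation "h ▷ b" := (br_act _ h b) (at level 35, right associativity).
Local Notation Delta := (br_Delta _).
Local Notation eps := (br_eps _).
Local Notation S := (br_S _).

Record weakDuality (C B : brHopf) := WeakDuality {
  wd_ev :> {bilinear C -> B -> k | *%R & *%R};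
  wd_act : forall (h : H) c b,
    \sw_(h1, h2 <- DeltaH h) wd_ev (h1 ▷ c) (h2 ▷ b) = epsH h * wd_ev c b;
  wd_mull : forall c c' b,
    wd_ev (c * c') b = \sw_(b1, b2 <- Delta b) wd_ev c b2 * wd_ev c' b1;
  wd_mulr : forall c b b',
    wd_ev c (b * b') = \sw_(c1, c2 <- Delta c) wd_ev c2 b * wd_ev c1 b';
  wd_1l : forall b, wd_ev 1 b = eps b;
  wd_1r : forall c, wd_ev c 1 = eps c;
  wd_S : forall c b, wd_ev (S c) b = wd_ev c (S b)
}.

(* The element [comod_coact a] is a^(0) (x) a^(-1). *)
Record comodAlg (C : brHopf) := ComodAlg {
  comod_alg :> pzAlgType k;
  comod_act : {bilinear H -> comod_alg -> comod_alg};
  comod_coact : {linear comod_alg -> comod_alg ⊗ C};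
  comod_module_algebra : is_module_algebra comod_act;
  comod_act_coact : forall h a, comod_coact (comod_act h a) =
    \sw_(h1, h2 <- DeltaH h) \sw_(a0, c <- comod_coact a)
      comod_act h1 a0 ⊠ (h2 ▷ c);
  comod_coassoc : forall a,
    \sw_(a0, c <- comod_coact a) \sw_(a00, c' <- comod_coact a0)
      a00 ⊠ (c' ⊠ c) =
    \sw_(a0, c <- comod_coact a) \sw_(c1, c2 <- Delta c) a0 ⊠ (c1 ⊠ c2);
  comod_counit : forall a, \sw_(a0, c <- comod_coact a) eps c *: a0 = a;
  comod_coactM : forall a a', comod_coact (a * a') =
    \sw_(a0, c <- comod_coact a) \sw_(a0', c' <- comod_coact a')
      \sw_(x, y <- braiding (br_act C) comod_act c a0') (a0 * x) ⊠ (y * c');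
  comod_coact1 : comod_coact 1 = (1 : comod_alg) ⊠ (1 : C)
}.

End Category.

Notation "h ▷ b" := (br_act _ h b) (at level 35, right associativity)
  : ring_scope.
Notation "h ▶ a" := (comod_act _ h a) (at level 35, right associativity)
  : ring_scope.


Section Double.
Variables (k : fieldType) (H : qtHopf k) (C B : brHopf H).
Variable ev : weakDuality C B.
Local Notation DeltaH := (qt_Delta H).
Local Notation R := (qt_R H).
Local Notation Rinv := (qt_Rinv H).

Record drin_relations (E : pzAlgType k) (jC : {linear C -> E})
    (jH : {linear H -> E}) (jB : {linear B -> E}) : Prop := {
  drin_jC : monoid_morphism jC;
  drin_jH : monoid_morphism jH;
  drin_jB : monoid_morphism jB;
  drin_cross : forall b c,
    \sw_(b1, b2 <- br_Delta B b) \sw_(c1, c2 <- br_Delta C c)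
      \sw_(p, q <- Rinv)
        ev c2 b1 *: (jB (p ▷ b2) * jC (q ▷ c1)) =
    \sw_(b1, b2 <- br_Delta B b) \sw_(c1, c2 <- br_Delta C c)
      \sw_(p, q <- Rinv) \sw_(r, s <- R)
        ev (q ▷ c1) (r ▷ b2) *: (jH p * jC c2 * jB b1 * jH s);
  drin_HB : forall h b,
    jH h * jB b = \sw_(h1, h2 <- DeltaH h) jB (h1 ▷ b) * jH h2;
  drin_HC : forall h c,
    jH h * jC c = \sw_(h1, h2 <- DeltaH h) jC (h1 ▷ c) * jH h2
}.

(* Drin_H(C,B): the algebra presented by the generators C, H, B and the
   relations [drin_relations] (those internal to C, H, B included), which is
   expressed by its universal property; with the bialgebra structure prescribed
   on generators. *)
Record drinDouble := DrinDouble {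
  dd_alg :> pzAlgType k;
  dd_C : {linear C -> dd_alg};
  dd_H : {linear H -> dd_alg};
  dd_B : {linear B -> dd_alg};
  dd_relations : drin_relations dd_C dd_H dd_B;
  dd_universal : forall (E : pzAlgType k) (jC : {linear C -> E})
      (jH : {linear H -> E}) (jB : {linear B -> E}),
    drin_relations jC jH jB ->
    exists f : {linear dd_alg -> E},
      [/\ monoid_morphism f, f \o dd_C =1 jC, f \o dd_H =1 jH
        & f \o dd_B =1 jB];
  dd_generated : forall (E : pzAlgType k) (f g : {linear dd_alg -> E}),
    monoid_morphism f -> monoid_morphism g ->
    f \o dd_C =1 g \o dd_C -> f \o dd_H =1 g \o dd_H ->
    f \o dd_B =1 g \o dd_B -> f =1 g;
  dd_Delta : {linear dd_alg -> dd_alg ⊗ dd_alg};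
  dd_eps : {scalar dd_alg};
  dd_bialgebra : is_bialgebra dd_Delta dd_eps;
  dd_DeltaH : forall h,
    dd_Delta (dd_H h) = \sw_(h1, h2 <- DeltaH h) dd_H h1 ⊠ dd_H h2;
  dd_DeltaB : forall b, dd_Delta (dd_B b) =
    \sw_(b1, b2 <- br_Delta B b) \sw_(r, s <- R)
      (dd_B b1 * dd_H s) ⊠ dd_B (r ▷ b2);
  dd_DeltaC : forall c, dd_Delta (dd_C c) =
    \sw_(c1, c2 <- br_Delta C c) \sw_(p, q <- Rinv)
      (dd_H p * dd_C c2) ⊠ dd_C (q ▷ c1);
  dd_epsH : forall h, dd_eps (dd_H h) = qt_eps H h;
  dd_epsB : forall b, dd_eps (dd_B b) = br_eps B b;
  dd_epsC : forall c, dd_eps (dd_C c) = br_eps C c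
}.

Record is_comodule_algebra (D : drinDouble) (P : pzAlgType k)
    (delta : {linear P -> D ⊗ P}) : Prop := {
  lcomod_coassoc : forall x,
    \sw_(d, y <- delta x) \sw_(d1, d2 <- dd_Delta D d) d1 ⊠ (d2 ⊠ y) =
    \sw_(d, y <- delta x) \sw_(d', y' <- delta y) d ⊠ (d' ⊠ y');
  lcomod_counit : forall x, \sw_(d, y <- delta x) dd_eps D d *: y = x;
  lcomod_coactM : monoid_morphism delta
}.

(* Q is a subalgebra of P and delta Q is contained in D (x) Q. *)
Record is_comodule_subalgebra (D : drinDouble) (P : pzAlgType k)
    (delta : {linear P -> D ⊗ P}) (Q : P -> Prop) : Prop := {
  subalg_linear : forall a x y, Q x -> Q y -> Q (a *: x + y);
  subalg_1 : Q 1;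
  subalg_mul : forall x y, Q x -> Q y -> Q (x * y);
  subalg_coact : forall x, Q x -> exists2 s : seq (D * P),
    (forall p, p \in s -> Q p.2) & delta x = \sum_(p <- s) p.1 ⊠ p.2
}.


Variable A : comodAlg C.

(* (Id_A (x) ev)(delta_A (x) Id_B) Psi_{B,A} (S (x) Id_A) : B (x) A -> A *)
Definition induced_action (b : B) (a : A) : A :=
  \sw_(x, y <- braiding (br_act B) (comod_act A) (br_S B b) a)
    \sw_(a0, c <- comod_coact A x) ev c y *: a0.

(* phi is a left B-module structure on A in the category of H-modules *)
Record is_left_module_in (phi : B -> A -> A) : Prop := {
  lmod_bilinear : bilinear_for *:%R *:%R phi;
  lmod_act : forall (h : H) b a,
    h ▶ phi b a = \sw_(h1, h2 <- DeltaH h) phi (h1 ▷ b) (h2 ▶ a);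
  lmod_1 : forall a, phi 1 a = a;
  lmod_M : forall b b' a, phi (b * b') a = phi b (phi b' a)
}.

Record tripleProduct := TripleProduct {
  tp_alg :> pzAlgType k;
  tp_A : {linear A -> tp_alg};
  tp_B : {linear B -> tp_alg};
  tp_H : {linear H -> tp_alg};
  tp_Amorph : monoid_morphism tp_A;
  tp_Bmorph : monoid_morphism tp_B;
  tp_Hmorph : monoid_morphism tp_H;
  (* the underlying vector space is A (x) B (x) H *)
  tp_bij : bijective (fun t : A ⊗ (B ⊗ H) =>
    \sw_(a, u <- t) \sw_(b, h <- u) tp_A a * tp_B b * tp_H h);
  tp_BA : forall b a, tp_B b * tp_A a =
    \sw_(r, s <- R) \sw_(a0, c <- comod_coact A (s ▶ a))
      \sw_(b1, b2 <- br_Delta B (r ▷ b))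
        ev c (br_S B b1) *: (tp_A a0 * tp_B b2);
  tp_HA : forall h a,
    tp_H h * tp_A a = \sw_(h1, h2 <- DeltaH h) tp_A (h1 ▶ a) * tp_H h2;
  tp_HB : forall h b,
    tp_H h * tp_B b = \sw_(h1, h2 <- DeltaH h) tp_B (h1 ▷ b) * tp_H h2
}.

(* The subspace A (x) B of A (x) B (x) H *)
Definition in_AB (P : tripleProduct) (x : P) : Prop :=
  exists t : A ⊗ B, x = \sw_(a, b <- t) tp_A P a * tp_B P b.

End Double.

(* Main.v *)
Require Import Defs.
From HB Require Import structures.
From mathcomp Require Import all_boot all_algebra.
Set Implicit Arguments.
Unset Strict Implicit.
Unset Printing Implicit Defensive.
Import GRing.Theory.
Local Open Scope ring_scope.

(** Notation of the comments: R = r ⊗ s and its inverse p ⊗ q, with primes for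
    further copies; R_ij is R with r in the i-th and s in the j-th factor of a
    tensor power of H, and R_(ij)k, R_i(jk) are its images under the coproduct.

    The relation of A ⋊ B ⋊ H between A and B writes b a as a combination of
    products of A by B that involves the antipode of B. It can be solved for
    the products of A by B, and the antipode disappears:
        a b = (p ▷ b_(2)) (q ▷ a^(0)) ev(a^(-1), b_(1)).
    Indeed both relations describe one invertible exchange of A ⊗ B with B ⊗ A
    ([cross_BA_AB], [cross_AB_BA]). The second form resembles the cross relation
    of Drin_H(C,B), and it is the one to transport.

    As A ⋊ B ⋊ H is spanned by the products a b h, an algebra morphism out of it
    is a triple of algebra morphisms on A, B and H whose images satisfy the
    three commutation relations ([tp_lift]). The values that the coaction must
    take on A, B, H satisfy them. The multiplicativity on A and on B and the
    relations with H follow from the hexagon identities and from the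
    quasi-cocommutativity of H. For the relation between A and B ([coactAB]),
    expand the image of a b, exchange A and B in the second tensor factor by the
    relation above, and B and C in the first one by the cross relation of the
    double; comparing the outcome with the images of the right-hand side leaves
    the identity
        R_45^-1 R_(123)5^-1 R_12^-1 R_43 = R_4(23) R_(23)5^-1 R_(14)(52)^-1
    in the fifth tensor power of H ([R_cross]).

    Coassociativity and the counit axiom compare algebra morphisms, hence hold
    as soon as they hold on generators ([tp_morphism_eq]). The products a b span
    a subalgebra because b a' is again a combination of such products.

    That B acts on A rests on the braided anti-multiplicativity of the antipode
    ([br_S_mul]): the pairing turns products of B into coproducts of C, hence
    into iterated coactions, and its H-invariance absorbs the copies of R that
    remain.

    All this is computed with nested Sweedler sums. The summands are multilinear
    in the bound variables, so an identity between tensors may be applied to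
    them, whatever the surrounding expression; the first part provides tactics
    for doing this below other sums. *)

(** * Multilinearity and rewriting in Sweedler sums *)

Section SweedlerCalculus.
Variable k : fieldType.
Implicit Types U V W X Y Z : lmodType k.

Lemma eq_sw V W (U : nmodType) (t : V ⊗ W) (F G : V -> W -> U) :
  (forall x y, F x y = G x y) -> sweedler t F = sweedler t G.
Proof. by move=> FG; apply: eq_bigr => p _; apply: FG. Qed.

Lemma sw_exch V W X Y (U : nmodType) (t : V ⊗ W) (u : X ⊗ Y)
    (F : V -> W -> X -> Y -> U) :
  \sw_(v, w <- t) \sw_(x, y <- u) F v w x y =
  \sw_(x, y <- u) \sw_(v, w <- t) F v w x y.
Proof. exact: exchange_big. Qed.

(** Bilinearity of a plain function, so that it can be asked of the body of a
    Sweedler sum. *)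
Definition bilinear2 V W U (F : V -> W -> U) :=
  (forall w, linear (fun v => F v w)) /\ (forall v, linear (F v)).

Lemma sw_tens V W U (F : V -> W -> U) v w : bilinear2 F ->
  sweedler (v ⊠ w) F = F v w.
Proof. by case=> lF rF; apply: sweedlerT. Qed.

Lemma linear_compose U V W (f : V -> W) (g : U -> V) :
  linear f -> linear g -> linear (fun x => f (g x)).
Proof. by move=> lf lg a x y; rewrite lg lf. Qed.

(** The regular module [k^o] is named because unification does not guess it from
    a function with values in [k]. *)
Lemma linear_compose_scalar U V (f : V -> k) (g : U -> V) :
  linear (f : V -> k^o) -> linear g -> linear ((fun x => f (g x)) : U -> k^o).
Proof. exact: (@linear_compose U V k^o). Qed.

Lemma linear_idfun U : linear (fun x : U => x).
Proof. by []. Qed.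

Lemma linear_sw V W X U (t : V ⊗ W) (F : X -> V -> W -> U) :
  (forall v w, linear (fun x => F x v w)) ->
  linear (fun x => sweedler t (F x)).
Proof. by move=> lF a x y; rewrite -sweedlerPr; apply: eq_sw => v w; apply: lF. Qed.

Lemma linear_swl V W U (F : V -> W -> U) :
  bilinear2 F -> linear (fun t : V ⊗ W => sweedler t F).
Proof. by case=> lF rF a x y; rewrite sweedlerP. Qed.

Lemma linear_fun0 U V (f : U -> V) : linear f -> f 0 = 0.
Proof. by move=> /(_ (-1) 0 0); rewrite scaler0 addr0 scaleN1r addNr. Qed.
Lemma linear_funD U V (f : U -> V) x y : linear f -> f (x + y) = f x + f y.
Proof. by move=> /(_ 1 x y); rewrite !scale1r. Qed.
Lemma linear_funZ U V (f : U -> V) a x : linear f -> f (a *: x) = a *: f x.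
Proof. by move=> lf; move: (lf a x 0); rewrite (linear_fun0 lf) !addr0. Qed.

(** Stated for a linear function that need not be bundled: the linear maps to be
    moved inside a sum are mostly contexts around it. *)
Lemma linear_of_sw V W X U (f : X -> U) (t : V ⊗ W) (F : V -> W -> X) :
  linear f -> f (sweedler t F) = sweedler t (fun v w => f (F v w)).
Proof.
move=> lf; rewrite /sweedler.
by elim: (repr t) => [|p s IH]; rewrite ?big_nil ?big_cons ?linear_fun0 ?linear_funD ?IH.
Qed.

Lemma sw_sw V W X Y U (t : V ⊗ W) (G : V -> W -> X ⊗ Y) (F : X -> Y -> U) :
  bilinear2 F ->
  sweedler (sweedler t G) F = \sw_(v, w <- t) sweedler (G v w) F.
Proof. by move=> bF; apply: (linear_of_sw _ _ (linear_swl bF)). Qed.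

Lemma sw_scale V W U (t : V ⊗ W) (F : V -> W -> U) (a : k) :
  a *: sweedler t F = \sw_(v, w <- t) a *: F v w.
Proof. exact: scaler_sumr. Qed.

Lemma scale_swl V W U (t : V ⊗ W) (F : V -> W -> k) (x : U) :
  sweedler t F *: x = \sw_(v, w <- t) F v w *: x.
Proof. exact: scaler_suml. Qed.

Lemma mul_swl V W (A : pzAlgType k) (t : V ⊗ W) (F : V -> W -> A) (x : A) :
  sweedler t F * x = \sw_(v, w <- t) F v w * x.
Proof. exact: mulr_suml. Qed.

Lemma mul_swr V W (A : pzAlgType k) (t : V ⊗ W) (F : V -> W -> A) (x : A) :
  x * sweedler t F = \sw_(v, w <- t) x * F v w.
Proof. exact: mulr_sumr. Qed.

Lemma linear_mull (A : pzAlgType k) (x : A) : linear (fun y : A => y * x).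
Proof. by move=> a y z; rewrite mulrDl -[(a *: y) * x]algscaleAl. Qed.
Lemma linear_mulr (A : pzAlgType k) (x : A) : linear (fun y : A => x * y).
Proof. by move=> a y z; rewrite mulrDr -[x * (a *: y)]algscaleAr. Qed.
Lemma alg_scaleAl (A : pzAlgType k) a (x y : A) : (a *: x) * y = a *: (x * y).
Proof. exact: esym (algscaleAl _ _ _). Qed.
Lemma alg_scaleAr (A : pzAlgType k) a (x y : A) : x * (a *: y) = a *: (x * y).
Proof. exact: esym (algscaleAr _ _ _). Qed.

Lemma linear_tensl V W (w : W) : linear (fun v : V => v ⊠ w).
Proof. by move=> a v v'; rewrite linearPl. Qed.
Lemma linear_tensr V W (v : V) : linear (fun w : W => v ⊠ w).
Proof. by move=> a w w'; rewrite linearPr. Qed.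

Lemma tens_swl V W X Y (t : V ⊗ W) (F : V -> W -> X) (y : Y) :
  sweedler t F ⊠ y = \sw_(v, w <- t) F v w ⊠ y.
Proof. exact: (linear_of_sw _ _ (@linear_tensl _ _ y)). Qed.
Lemma tens_swr V W X Y (t : V ⊗ W) (F : V -> W -> Y) (x : X) :
  x ⊠ sweedler t F = \sw_(v, w <- t) x ⊠ F v w.
Proof. exact: (linear_of_sw _ _ (@linear_tensr _ _ x)). Qed.
Lemma tens_scaler V W a (v : V) (w : W) : v ⊠ (a *: w) = a *: (v ⊠ w).
Proof. exact: (linear_funZ _ _ (@linear_tensr _ _ v)). Qed.
Lemma tens_mul (A B : pzAlgType k) (a : A) (b : B) (a' : A) (b' : B) :
  (a ⊠ b) * (a' ⊠ b') = (a * a') ⊠ (b * b').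
Proof. exact: tensor_mulT. Qed.

Lemma linear_scaleby U V (f : U -> k) (v : V) :
  linear (f : U -> k^o) -> linear (fun x => f x *: v).
Proof. by move=> lf a x y; rewrite -[f _]/((f : U -> k^o) _) lf scalerDl scalerA. Qed.

Lemma linear_bundled U V (f : {linear U -> V}) : linear f.
Proof. exact: linearP. Qed.
Lemma linear_bundled_scalar U (f : {scalar U}) : linear (f : U -> k^o).
Proof. by move=> a x y; rewrite [LHS]linearP. Qed.
Lemma linear_bilinearl U V W (f : {bilinear U -> V -> W}) v :
  linear (fun u => f u v).
Proof. by move=> a x y; rewrite linearPl. Qed.
Lemma linear_bilinearr U V W (f : {bilinear U -> V -> W}) u : linear (f u).
Proof. by move=> a x y; rewrite linearPr. Qed.
Lemma linear_formkl U V (f : {bilinear U -> V -> k | *%R & *%R}) v :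
  linear ((fun u => f u v) : U -> k^o).
Proof. by move=> a x y; rewrite linearPl. Qed.
Lemma linear_formkr U V (f : {bilinear U -> V -> k | *%R & *%R}) u :
  linear (f u : V -> k^o).
Proof. by move=> a x y; rewrite linearPr. Qed.

Lemma bundled_sw V W X U (f : {linear X -> U}) (t : V ⊗ W) (F : V -> W -> X) :
  f (sweedler t F) = \sw_(v, w <- t) f (F v w).
Proof. exact: (linear_of_sw _ _ (linear_bundled f)). Qed.

Definition trilinear U V W X (F : U -> V -> W -> X) :=
  [/\ forall v w, linear (fun u => F u v w), forall u w, linear (fun v => F u v w)
    & forall u v, linear (F u v)].

Lemma linear_scale (a : k) V : linear (fun v : V => a *: v).
Proof. by move=> b x y; rewrite scalerDr !scalerA mulrC. Qed.
End SweedlerCalculus.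

Ltac lin_base :=
  first [ exact: linear_idfun | apply: linear_bundled | apply: linear_bundled_scalar
        | apply: linear_bilinearl | apply: linear_bilinearr
        | apply: linear_formkl | apply: linear_formkr
        | apply: linear_mull | apply: linear_mulr
        | apply: linear_tensl | apply: linear_tensr | apply: linear_scale
        | match goal with lF : _ |- _ => apply: lF end
        | match goal with lF : bilinear2 _ |- _ => apply: lF.1 end
        | match goal with lF : bilinear2 _ |- _ => apply: lF.2 end
        | match goal with lF : trilinear _ |- _ =>
            case: (lF) => ? ? ?; match goal with lG : _ |- _ => apply: lG end end ].

(** Proves that an expression is linear in a variable that occurs in it once:
    it peels off sums, scalars and maps until the variable is reached. The
    arguments of [lin_arg2] to [lin_arg5] are the trailing arguments of the
    expression already known not to contain the variable. The explicit test for
    a constant function is needed because a pattern variable in head position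
    may capture the variable. *)
Ltac lin :=
  lazymatch goal with
  | |- forall _, _ => intro; lin
  | |- bilinear2 _ => split=> ?; lin
  | |- trilinear _ => split=> ? ?; lin
  | |- GRing.linear_for ?s ?f =>
    change (GRing.linear_for s (fun x => f x)); cbv beta; lin_step
  end
with lin_step :=
  lazymatch goal with
  | |- GRing.linear_for _ (fun x => x) => exact: linear_idfun
  | |- GRing.linear_for _ (fun x => sweedler (@?tensor x) (@?summand x)) =>
    lazymatch summand with
    | (fun _ => ?outer) =>
      lazymatch tensor with
      | (fun y => y) => apply: linear_swl; lin
      | _ => apply: (linear_compose (f := fun y => sweedler y outer) (g := tensor));
          [apply: linear_swl; lin | lin]
      end
    | _ => apply: linear_sw => ? ?; lin
    end
  | |- GRing.linear_for _ (fun x => @GRing.scale _ _ (@?coeff x) (@?inner x)) =>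
    lazymatch coeff with
    | (fun _ => ?a) =>
      apply: (linear_compose (f := fun y => a *: y) (g := inner));
        [exact: linear_scale | lin]
    | _ => apply: (linear_scaleby (f := coeff)); lin
    end
  | |- GRing.linear_for _ (fun x => ?F (@?inner x)) =>
    lazymatch inner with (fun _ => ?a) => lin_arg2 a | _ => lin_at F inner end
  end
with lin_arg2 a :=
  lazymatch goal with |- GRing.linear_for _ (fun x => ?F (@?inner x) a) =>
    lazymatch inner with
    | (fun _ => ?b) => lin_arg3 b a
    | _ => lin_at (fun y => F y a) inner
    end end
with lin_arg3 b a :=
  lazymatch goal with |- GRing.linear_for _ (fun x => ?F (@?inner x) b a) =>
    lazymatch inner with
    | (fun _ => ?c) => lin_arg4 c b a
    | _ => lin_at (fun y => F y b a) inner
    end end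
with lin_arg4 c b a :=
  lazymatch goal with |- GRing.linear_for _ (fun x => ?F (@?inner x) c b a) =>
    lazymatch inner with
    | (fun _ => ?d) => lin_arg5 d c b a
    | _ => lin_at (fun y => F y c b a) inner
    end end
with lin_arg5 d c b a :=
  lazymatch goal with |- GRing.linear_for _ (fun x => ?F (@?inner x) d c b a) =>
    lin_at (fun y => F y d c b a) inner
  end
with lin_at outer inner :=
  lazymatch inner with
  | (fun x => x) => lin_base
  | _ => first [ apply: (linear_compose (f := outer) (g := inner))
               | apply: (linear_compose_scalar (f := outer) (g := inner)) ];
         [lin_base | lin]
  end.

(** Runs a rewriting tactic on the left-hand side, below as few of the leading
    sums as possible. *)
Ltac deep tac :=
  first [ tac; reflexivity
        | apply: eq_sw => ? ?; deep tac ].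

(** Rewriting inside a nested sum, on either side of an equation; [lhsat n]
    works exactly below the first n sums. The multilinearity conditions of the
    rewriting lemmas go to [lin]. *)
Tactic Notation "lhs" tactic3(tac) :=
  eapply eq_trans; [deep ltac:(tac; [|lin ..]) | cbv beta].
Tactic Notation "rhs" tactic3(tac) :=
  symmetry; lhs tac; symmetry.
Tactic Notation "lhsat" int_or_var(n) tactic3(tac) :=
  eapply eq_trans; [do n (apply: eq_sw => ? ?); tac; [reflexivity|lin ..] | cbv beta].
Tactic Notation "rhsat" int_or_var(n) tactic3(tac) :=
  symmetry; lhsat n tac; symmetry.

(** Exchanges the sums number n and n + 1 (counted from 0) of the left-hand
    side, which must be independent. *)
Tactic Notation "exch" int_or_var(n) :=
  eapply eq_trans; [do n (apply: eq_sw => ? ?); apply: sw_exch | cbv beta].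

(** The goal being an expression equal to an unknown function of given terms,
    the function is found by abstracting these terms. *)
Ltac abs1 a :=
  lazymatch goal with |- ?L = ?G _ =>
    let L' := eval pattern a in L in
    lazymatch L' with ?f _ => unify G f end end.
Ltac absmul :=
  lazymatch goal with |- ?L = _ ?t =>
    match L with context [?a * ?b] => unify t (a * b); abs1 (a * b) end end.
Ltac abs2 a b :=
  lazymatch goal with |- ?L = ?G _ _ =>
    let L' := eval pattern a, b in L in
    lazymatch L' with ?f _ _ => unify G f end end.
Ltac abs3 a b c :=
  lazymatch goal with |- ?L = ?G _ _ _ =>
    let L' := eval pattern a, b, c in L in
    lazymatch L' with ?f _ _ _ => unify G f end end.

Ltac fold_summand tac :=
  let x := fresh "x" in let y := fresh "y" in
  apply: eq_sw; intros x y; tac x y; reflexivity.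
Ltac fold_summand2 tac :=
  let x := fresh "x" in let y := fresh "y" in
  let z := fresh "z" in let w := fresh "w" in
  apply: eq_sw; intros x y; apply: eq_sw; intros z w; tac x y z w; reflexivity.

(** Rewriting with a lemma about sums of [F (r * p) (s * q)], say: [F] is then
    out of reach of unification. The tactic argument receives the variables
    bound by the two sums (by the one sum for [lhsfold1]) and exhibits the
    arguments of [F]; an arrow means that the lemma is used from right to
    left. *)
Tactic Notation "lhsfold" constr(lem) tactic3(tac) :=
  eapply eq_trans;
  [ deep ltac:(eapply eq_trans; [ | apply: lem]; [fold_summand2 tac | lin ..])
  | cbv beta].
Tactic Notation "lhsfold" "<-" constr(lem) tactic3(tac) :=
  eapply eq_trans;
  [ deep ltac:(eapply eq_trans; [ | symmetry; apply: lem]; [fold_summand2 tac | lin ..])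
  | cbv beta].
Tactic Notation "rhsfold" constr(lem) tactic3(tac) :=
  symmetry; lhsfold lem tac; symmetry.
Tactic Notation "lhsfold1" constr(lem) tactic3(tac) :=
  eapply eq_trans;
  [ deep ltac:(eapply eq_trans; [ | apply: lem]; [fold_summand tac | lin ..])
  | cbv beta].
Tactic Notation "lhsfold1" "<-" constr(lem) tactic3(tac) :=
  eapply eq_trans;
  [ deep ltac:(eapply eq_trans; [ | symmetry; apply: lem]; [fold_summand tac | lin ..])
  | cbv beta].

(** * The universal R-matrix *)

Section Transport.
Variables (k : fieldType) (U V W X : lmodType k).
Variables (V1 V2 V3 V4 V1' V2' V3' V4' : lmodType k).

Lemma sw2_sw2 (F : U -> V -> X) (t : V1 ⊗ V2) (t' : V1 -> V2 -> V3 ⊗ V4)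
    f g : bilinear2 F ->
  sweedler (\sw_(x, y <- t) \sw_(z, w <- t' x y) f x y z w ⊠ g x y z w) F =
  \sw_(x, y <- t) \sw_(z, w <- t' x y) F (f x y z w) (g x y z w).
Proof.
move=> bF; rewrite sw_sw //; apply: eq_sw => x y; rewrite sw_sw //.
by apply: eq_sw => z w; rewrite sw_tens.
Qed.

Lemma sw3_sw2 (F : U -> V -> W -> X)
    (t : V1 ⊗ V2) (t' : V1 -> V2 -> V3 ⊗ V4) f g h : trilinear F ->
  sweedler (\sw_(x, y <- t) \sw_(z, w <- t' x y) f x y z w ⊠ (g x y z w ⊠ h x y z w))
     (fun x t => \sw_(y, z <- t) F x y z) =
  \sw_(x, y <- t) \sw_(z, w <- t' x y) F (f x y z w) (g x y z w) (h x y z w).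
Proof.
move=> lF; have [l1 l2 l3] := lF.
rewrite sw_sw; last by lin.
apply: eq_sw => x y; rewrite sw_sw; last by lin.
apply: eq_sw => z w; rewrite sw_tens; last by lin.
by rewrite sw_tens //; lin.
Qed.
End Transport.

(** An equality of tensors may be evaluated in any bilinear map. This and
    [sw_eq3] turn the axioms, stated as equalities of tensors, into rewriting
    rules below an arbitrary multilinear context. *)
Lemma sw_eq2 (k : fieldType) (U V X V1 V2 V3 V4 V1' V2' V3' V4' : lmodType k)
    (F : U -> V -> X) (t : V1 ⊗ V2) (t' : V1 -> V2 -> V3 ⊗ V4) f g
    (u : V1' ⊗ V2') (u' : V1' -> V2' -> V3' ⊗ V4') f' g' : bilinear2 F ->
  \sw_(x, y <- t) \sw_(z, w <- t' x y) f x y z w ⊠ g x y z w =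
  \sw_(x, y <- u) \sw_(z, w <- u' x y) f' x y z w ⊠ g' x y z w ->
  \sw_(x, y <- t) \sw_(z, w <- t' x y) F (f x y z w) (g x y z w) =
  \sw_(x, y <- u) \sw_(z, w <- u' x y) F (f' x y z w) (g' x y z w).
Proof. by move=> bF tu; rewrite -(sw2_sw2 t _ _ _ bF) tu (sw2_sw2 _ _ _ _ bF). Qed.

Lemma sw_eq3 (k : fieldType) (U V W X V1 V2 V3 V4 V1' V2' V3' V4' : lmodType k)
    (F : U -> V -> W -> X) (t : V1 ⊗ V2) (t' : V1 -> V2 -> V3 ⊗ V4) f g h
    (u : V1' ⊗ V2') (u' : V1' -> V2' -> V3' ⊗ V4') f' g' h' : trilinear F ->
  \sw_(x, y <- t) \sw_(z, w <- t' x y) f x y z w ⊠ (g x y z w ⊠ h x y z w) =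
  \sw_(x, y <- u) \sw_(z, w <- u' x y) f' x y z w ⊠ (g' x y z w ⊠ h' x y z w) ->
  \sw_(x, y <- t) \sw_(z, w <- t' x y) F (f x y z w) (g x y z w) (h x y z w) =
  \sw_(x, y <- u) \sw_(z, w <- u' x y) F (f' x y z w) (g' x y z w) (h' x y z w).
Proof. by move=> bF tu; rewrite -(sw3_sw2 t _ _ _ _ bF) tu (sw3_sw2 _ _ _ _ _ bF). Qed.

Section Generic.
Variable k : fieldType.
Lemma algM_sw (A B : pzAlgType k) (U : lmodType k) (F : A -> B -> U) (t u : A ⊗ B) :
  bilinear2 F ->
  sweedler (t * u) F = \sw_(a, b <- t) \sw_(a', b' <- u) F (a * a') (b * b').
Proof. by move=> bF; rewrite tensor_mulE sw2_sw2. Qed.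
Lemma algone_sw (A B : pzAlgType k) (U : lmodType k) (F : A -> B -> U) :
  bilinear2 F -> sweedler (1 : A ⊗ B) F = F 1 1.
Proof. by move=> bF; rewrite tensor_oneE sw_tens. Qed.

Variables (C : lmodType k) (Delta : {linear C -> C ⊗ C}) (eps : {scalar C}).
Hypothesis coC : is_coalgebra Delta eps.
Lemma coassoc_sw (U : lmodType k) (F : C -> C -> C -> U) c : trilinear F ->
  \sw_(x, y <- Delta c) \sw_(x1, x2 <- Delta x) F x1 x2 y =
  \sw_(x, y <- Delta c) \sw_(y1, y2 <- Delta y) F x y1 y2.
Proof. by move=> lF; apply: (sw_eq3 lF (coalg_coassoc coC c)). Qed.
Lemma counitl_sw (U : lmodType k) (F : C -> U) c : linear F ->
  \sw_(x, y <- Delta c) eps x *: F y = F c.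
Proof.
move=> lF; rewrite -[in RHS](coalg_counitl coC c) (linear_of_sw _ _ lF).
by apply: eq_sw => x y; rewrite (linear_funZ _ _ lF).
Qed.
Lemma counitr_sw (U : lmodType k) (F : C -> U) c : linear F ->
  \sw_(x, y <- Delta c) eps y *: F x = F c.
Proof.
move=> lF; rewrite -[in RHS](coalg_counitr coC c) (linear_of_sw _ _ lF).
by apply: eq_sw => x y; rewrite (linear_funZ _ _ lF).
Qed.
End Generic.

Section QuasiTriangular.
Variables (k : fieldType) (H : qtHopf k).
Local Notation DeltaH := (qt_Delta H).
Local Notation epsH := (qt_eps H).
Local Notation R := (qt_R H).
Local Notation Rinv := (qt_Rinv H).
Implicit Types U : lmodType k.

Lemma R_hexagonl U (F : H -> H -> H -> U) : trilinear F ->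
  \sw_(r, s <- R) \sw_(r1, r2 <- DeltaH r) F r1 r2 s =
  \sw_(r, s <- R) \sw_(r', s' <- R) F r r' (s * s').
Proof. by move=> lF; apply: (sw_eq3 lF (qt_hexagonl H)). Qed.
Lemma R_hexagonr U (F : H -> H -> H -> U) : trilinear F ->
  \sw_(r, s <- R) \sw_(s1, s2 <- DeltaH s) F r s1 s2 =
  \sw_(r, s <- R) \sw_(r', s' <- R) F (r * r') s' s.
Proof. by move=> lF; apply: (sw_eq3 lF (qt_hexagonr H)). Qed.
Lemma R_DeltaH U (F : H -> H -> U) h : bilinear2 F ->
  \sw_(r, s <- R) \sw_(h1, h2 <- DeltaH h) F (r * h1) (s * h2) =
  \sw_(r, s <- R) \sw_(h1, h2 <- DeltaH h) F (h2 * r) (h1 * s).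
Proof. by move=> lF; apply: (sw_eq2 lF (qt_quasicocomm h)). Qed.
Lemma R_Rinv U (F : H -> H -> U) : bilinear2 F ->
  \sw_(r, s <- R) \sw_(p, q <- Rinv) F (r * p) (s * q) = F 1 1.
Proof. by move=> lF; rewrite -algM_sw // qt_mulRRinv algone_sw. Qed.
Lemma Rinv_R U (F : H -> H -> U) : bilinear2 F ->
  \sw_(p, q <- Rinv) \sw_(r, s <- R) F (p * r) (q * s) = F 1 1.
Proof. by move=> lF; rewrite -algM_sw // qt_mulRinvR algone_sw. Qed.

Lemma Delta1_sw U (F : H -> H -> U) : bilinear2 F ->
  sweedler (DeltaH 1) F = F 1 1.
Proof. by move=> bF; rewrite (bialg_DeltaM (qt_bialgebra H)).1 algone_sw. Qed.
Lemma DeltaM_sw U (F : H -> H -> U) g h : bilinear2 F ->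
  sweedler (DeltaH (g * h)) F =
  \sw_(g1, g2 <- DeltaH g) \sw_(h1, h2 <- DeltaH h) F (g1 * h1) (g2 * h2).
Proof. by move=> bF; rewrite (bialg_DeltaM (qt_bialgebra H)).2 algM_sw. Qed.

Lemma left_inv_eq_right_inv (A : pzRingType) (x y z : A) : y * x = 1 -> x * z = 1 -> y = z.
Proof. by move=> yx xz; rewrite -[y]mulr1 -xz mulrA yx mul1r. Qed.

Lemma epsM g h : epsH (g * h) = epsH g * epsH h.
Proof. by rewrite (bialg_epsM (qt_bialgebra H)).2. Qed.
Lemma eps1 : epsH 1 = 1.
Proof. by rewrite (bialg_epsM (qt_bialgebra H)).1. Qed.

(** R^-1 satisfies the opposite hexagon identities, since both sides are the
    inverse of the corresponding expression in R. *)
Lemma Rinv_hexagonl_tens :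
  \sw_(p, q <- Rinv) \sw_(p1, p2 <- DeltaH p) p1 ⊠ (p2 ⊠ q) =
  \sw_(p, q <- Rinv) \sw_(p', q' <- Rinv) p ⊠ (p' ⊠ (q' * q)).
Proof.
symmetry.
apply: (@left_inv_eq_right_inv (tensor H (tensor H H))
   (\sw_(r, s <- R) \sw_(r1, r2 <- DeltaH r) r1 ⊠ (r2 ⊠ s))).
  rewrite qt_hexagonl.
  do 2 lhs rewrite mul_swl.
  do 2 lhs rewrite mul_swr.
  lhs rewrite !tens_mul.
  exch 0. exch 2. exch 1.
  (* The product telescopes: the inner factors cancel first. *)
  lhsfold (@Rinv_R) (fun p q r s => rewrite -!mulrA (mulrA q s); abs2 (p * r) (q * s)).
  lhsfold (@Rinv_R) (fun p q r s => rewrite mul1r; abs2 (p * r) (q * s)).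
  by [].
do 2 lhs rewrite mul_swl.
do 2 lhs rewrite mul_swr.
lhs rewrite !tens_mul.
exch 1.
lhsfold <- (@DeltaM_sw) (fun r1 r2 p1 p2 => abs2 (r1 * p1) (r2 * p2)).
lhsfold (@R_Rinv) (fun p q r s => abs2 (p * r) (q * s)).
by rewrite Delta1_sw //; lin.
Qed.

Lemma Rinv_hexagonr_tens :
  \sw_(p, q <- Rinv) \sw_(q1, q2 <- DeltaH q) p ⊠ (q1 ⊠ q2) =
  \sw_(p, q <- Rinv) \sw_(p', q' <- Rinv) (p * p') ⊠ (q ⊠ q').
Proof.
symmetry.
apply: (@left_inv_eq_right_inv (tensor H (tensor H H))
   (\sw_(r, s <- R) \sw_(s1, s2 <- DeltaH s) r ⊠ (s1 ⊠ s2))).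
  rewrite qt_hexagonr.
  do 2 lhs rewrite mul_swl.
  do 2 lhs rewrite mul_swr.
  lhs rewrite !tens_mul.
  exch 2. exch 1.
  lhsfold (@Rinv_R) (fun p q r s => rewrite -!mulrA (mulrA p r); abs2 (p * r) (q * s)).
  lhsfold (@Rinv_R) (fun p q r s => rewrite mul1r; abs2 (p * r) (q * s)).
  by [].
do 2 lhs rewrite mul_swl.
do 2 lhs rewrite mul_swr.
lhs rewrite !tens_mul.
exch 1.
lhsfold <- (@DeltaM_sw) (fun r1 r2 p1 p2 => abs2 (r1 * p1) (r2 * p2)).
lhsfold (@R_Rinv) (fun p q r s => abs2 (p * r) (q * s)).
by rewrite Delta1_sw //; lin.
Qed.

Lemma Rinv_hexagonl U (F : H -> H -> H -> U) : trilinear F ->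
  \sw_(p, q <- Rinv) \sw_(p1, p2 <- DeltaH p) F p1 p2 q =
  \sw_(p, q <- Rinv) \sw_(p', q' <- Rinv) F p p' (q' * q).
Proof. by move=> lF; apply: (sw_eq3 lF Rinv_hexagonl_tens). Qed.
Lemma Rinv_hexagonr U (F : H -> H -> H -> U) : trilinear F ->
  \sw_(p, q <- Rinv) \sw_(q1, q2 <- DeltaH q) F p q1 q2 =
  \sw_(p, q <- Rinv) \sw_(p', q' <- Rinv) F (p * p') q q'.
Proof. by move=> lF; apply: (sw_eq3 lF Rinv_hexagonr_tens). Qed.

(** Quasi-cocommutativity multiplied by R^-1 on both sides. *)
Lemma Rinv_DeltaH_tens h :
  \sw_(h1, h2 <- DeltaH h) \sw_(p, q <- Rinv) (h1 * p) ⊠ (h2 * q) =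
  \sw_(h1, h2 <- DeltaH h) \sw_(p, q <- Rinv) (p * h2) ⊠ (q * h1).
Proof.
transitivity (DeltaH h * Rinv); first by [].
set Dop : H ⊗ H := \sw_(h1, h2 <- DeltaH h) h2 ⊠ h1.
transitivity (Rinv * Dop); last first.
  rewrite /Dop mul_swr; apply: eq_sw => h1 h2.
  rewrite {1}[Rinv]tensorE mul_swl; apply: eq_sw => p q.
  by rewrite [LHS]tensor_mulT.
have E : R * DeltaH h = Dop * R.
  rewrite [LHS]tensor_mulE qt_quasicocomm.
  rewrite /Dop mul_swl; exch 0; apply: eq_sw => h1 h2.
  rewrite [in RHS](tensorE R) mul_swr; apply: eq_sw => p q.
  by rewrite [RHS]tensor_mulT.
by rewrite -[DeltaH h]mul1r -(qt_mulRinvR H) -!mulrA [R * _]mulrA E -mulrA qt_mulRRinv mulr1.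
Qed.
Lemma Rinv_DeltaH U (F : H -> H -> U) h : bilinear2 F ->
  \sw_(h1, h2 <- DeltaH h) \sw_(p, q <- Rinv) F (h1 * p) (h2 * q) =
  \sw_(h1, h2 <- DeltaH h) \sw_(p, q <- Rinv) F (p * h2) (q * h1).
Proof. by move=> lF; apply: (sw_eq2 lF (Rinv_DeltaH_tens h)). Qed.

Let coH := bialg_coalgebra (qt_bialgebra H).

(** Applying the counit to the first two factors of the hexagon identity shows
    that [(eps ⊗ id) R] equals its own square; it is invertible, hence 1. The
    invertibility enters through an inserted R R^-1. *)
Lemma R_epsl U (F : H -> U) : linear F -> \sw_(r, s <- R) epsH r *: F s = F 1.
Proof.
move=> lF.
transitivity (\sw_(r, s <- R) \sw_(r', s' <- R) \sw_(p, q <- Rinv)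
   epsH r *: (epsH (r' * p) *: F (s * (s' * q)))).
  rhsfold (@R_Rinv) (fun p q r s => abs2 (p * r) (q * s)).
  by apply: eq_sw => r s; rewrite mulr1 eps1 scale1r.
lhs rewrite mulrA.
lhs rewrite epsM -scalerA.
lhsfold <- (@R_hexagonl) (fun r s r' s' => abs3 r r' (s * s')).
exch 1.
rewrite -[RHS]scale1r -eps1.
lhs rewrite (counitl_sw coH).
lhs rewrite scalerA -epsM.
by lhsfold (@R_Rinv) (fun p q r s => abs2 (p * r) (q * s)).
Qed.

Lemma R_epsr U (F : H -> U) : linear F -> \sw_(r, s <- R) epsH s *: F r = F 1.
Proof.
move=> lF.
transitivity (\sw_(r, s <- R) \sw_(r', s' <- R) \sw_(p, q <- Rinv)
   epsH s *: (epsH (s' * q) *: F (r * (r' * p)))).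
  rhsfold (@R_Rinv) (fun p q r s => abs2 (p * r) (q * s)).
  by apply: eq_sw => r s; rewrite mulr1 eps1 scale1r.
lhs rewrite mulrA.
lhs rewrite epsM -scalerA.
lhsfold <- (@R_hexagonr) (fun r s r' s' => abs3 (r * r') s' s).
exch 1.
rewrite -[RHS]scale1r -eps1.
lhs rewrite (counitr_sw coH).
lhs rewrite scalerA -epsM.
by lhsfold (@R_Rinv) (fun p q r s => abs2 (p * r) (q * s)).
Qed.

(** Inserting the counital form of R next to R^-1 makes the two cancel. *)
Lemma Rinv_epsl U (F : H -> U) : linear F ->
  \sw_(p, q <- Rinv) epsH p *: F q = F 1.
Proof.
move=> lF.
transitivity (\sw_(p, q <- Rinv) \sw_(r, s <- R) epsH p *: (epsH r *: F (q * s))).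
  apply: eq_sw => p q; rewrite -sw_scale (R_epsl (F := fun s => F (q * s))) ?mulr1 //.
  by lin.
lhs rewrite scalerA -epsM.
lhsfold (@Rinv_R) (fun p q r s => abs2 (p * r) (q * s)).
by rewrite eps1 scale1r.
Qed.

Lemma Rinv_epsr U (F : H -> U) : linear F ->
  \sw_(p, q <- Rinv) epsH q *: F p = F 1.
Proof.
move=> lF.
transitivity (\sw_(p, q <- Rinv) \sw_(r, s <- R) epsH q *: (epsH s *: F (p * r))).
  apply: eq_sw => p q; rewrite -sw_scale (R_epsr (F := fun s => F (p * s))) ?mulr1 //.
  by lin.
lhs rewrite scalerA -epsM.
lhsfold (@Rinv_R) (fun p q r s => abs2 (p * r) (q * s)).
by rewrite eps1 scale1r.
Qed.
End QuasiTriangular.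

Section RCross.
Variables (k : fieldType) (H : qtHopf k) (U : lmodType k).
Local Notation DeltaH := (qt_Delta H).
Local Notation R := (qt_R H).
Local Notation Rinv := (qt_Rinv H).

(** The identity
      R_45^-1 R_(123)5^-1 R_12^-1 R_43 = R_4(23) R_(23)5^-1 R_(14)(52)^-1
    in the fifth tensor power of H, evaluated in a multilinear map. On the right,
    R_(14)(52)^-1 splits into R_45^-1 R_42^-1 R_15^-1 R_12^-1, and
    R_(23)5^-1 R_45^-1 is the image of R^-1 under an iterated coproduct, through
    which R_4(23) passes by quasi-cocommutativity. Then R_4(23) splits into
    R_43 R_42, whose second factor cancels R_42^-1. *)
Lemma R_cross (F : H -> H -> H -> H -> H -> U) :
  (forall v w x y, linear (fun u => F u v w x y)) ->
  (forall u w x y, linear (fun v => F u v w x y)) ->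
  (forall u v x y, linear (fun w => F u v w x y)) ->
  (forall u v w y, linear (fun x => F u v w x y)) ->
  (forall u v w x, linear (F u v w x)) ->
  \sw_(p, q <- Rinv) \sw_(p1, x <- DeltaH p) \sw_(p2, p3 <- DeltaH x)
    \sw_(r, s <- R) \sw_(p', q' <- Rinv) \sw_(p'', q'' <- Rinv)
      F (p1 * p'') (p2 * q'') (p3 * s) (p' * r) (q' * q) =
  \sw_(p, q <- Rinv) \sw_(p1, p2 <- DeltaH p) \sw_(q1, q2 <- DeltaH q)
    \sw_(r, s <- R) \sw_(p', q' <- Rinv)
    \sw_(s1, s2 <- DeltaH s) \sw_(x1, x2 <- DeltaH p')
      F p1 (s1 * (x1 * q2)) (s2 * x2) (r * p2) (q' * q1).
Proof.
move=> l1 l2 l3 l4 l5; symmetry.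
lhs rewrite Rinv_hexagonl.
lhs rewrite DeltaM_sw.
lhs rewrite Rinv_hexagonr.
exch 2. exch 1.
lhs rewrite Rinv_hexagonr.

(* R_(23)5^-1 and R_45^-1 are joined into one copy of R^-1, and the coproducts
   of its middle leg and of the second leg of R into that of a product. *)
exch 4. exch 3.
lhs rewrite [X in F _ _ _ _ X]mulrA.
lhsfold <- (@Rinv_hexagonl) (fun p q p' q' => abs3 p p' (q' * q)).
lhs rewrite [X in F _ X]mulrA.
lhsfold <- (@DeltaM_sw) (fun r1 r2 p1 p2 => abs2 (r1 * p1) (r2 * p2)).
(* Quasi-cocommutativity, for the first leg of the joined copy. *)
exch 4. exch 3.
lhs rewrite [X in F _ _ _ X]mulrA.
lhsfold (@R_DeltaH) (fun r s h1 h2 => abs2 (r * h1) (s * h2)).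
lhs rewrite DeltaM_sw.
exch 6. exch 5. exch 4.
lhs rewrite R_hexagonr.
(* R_42 against R_42^-1. *)
exch 4. exch 6. exch 5.
lhsfold (@R_Rinv) (fun r s p q => rewrite -!mulrA (mulrA s q); abs2 (r * p) (s * q)).
lhs rewrite mul1r mulr1.
(* It remains to split off R_45^-1 and to gather R_35^-1, R_25^-1 and R_15^-1
   into R_(123)5^-1. *)
exch 3.
lhs rewrite Rinv_hexagonl.
exch 1.
lhs rewrite -[X in F _ _ _ _ X]mulrA.
lhsfold <- (@Rinv_hexagonl) (fun p q p' q' => abs3 p p' (q' * q)).
exch 4. exch 3. exch 2. exch 4. exch 3. exch 4.
by [].
Qed.
End RCross.

(** * Braided Hopf algebras *)

Section BraidedHopf.
Variables (k : fieldType) (H : qtHopf k) (B : brHopf H).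
Local Notation DeltaH := (qt_Delta H).
Local Notation epsH := (qt_eps H).
Local Notation R := (qt_R H).
Local Notation Delta := (br_Delta B).
Local Notation eps := (br_eps B).
Local Notation S := (br_S B).
Implicit Types (U : lmodType k) (g h : H) (b : B).

Lemma br_act1 b : 1 ▷ b = b.
Proof. by rewrite (module_act1 (modalg_module (br_module_algebra B))). Qed.
Lemma br_actM g h b : (g * h) ▷ b = g ▷ (h ▷ b).
Proof. by rewrite (module_actM (modalg_module (br_module_algebra B))). Qed.
Lemma br_act_mul h b b' : h ▷ (b * b') = \sw_(h1, h2 <- DeltaH h) (h1 ▷ b) * (h2 ▷ b').
Proof. exact: (modalg_actM (br_module_algebra B)). Qed.
Lemma br_act_one h : h ▷ 1 = epsH h *: (1 : B).
Proof. exact: (modalg_act1 (br_module_algebra B)). Qed.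
Lemma br_act_mul_sw U (F : B -> U) h b b' : linear F ->
  F (h ▷ (b * b')) = \sw_(h1, h2 <- DeltaH h) F ((h1 ▷ b) * (h2 ▷ b')).
Proof. by move=> lF; rewrite br_act_mul (linear_of_sw _ _ lF). Qed.

Lemma br_Delta_act U (F : B -> B -> U) h b : bilinear2 F ->
  sweedler (Delta (h ▷ b)) F =
  \sw_(h1, h2 <- DeltaH h) \sw_(b1, b2 <- Delta b) F (h1 ▷ b1) (h2 ▷ b2).
Proof. by move=> bF; rewrite br_act_Delta sw2_sw2. Qed.

Lemma br_Delta_mul U (F : B -> B -> U) b b' : bilinear2 F ->
  sweedler (Delta (b * b')) F =
  \sw_(b1, b2 <- Delta b) \sw_(b1', b2' <- Delta b')
    \sw_(r, s <- R) F (b1 * (s ▷ b1')) ((r ▷ b2) * b2').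
Proof.
move=> bF; rewrite br_DeltaM sw_sw //; apply: eq_sw => b1 b2.
rewrite sw_sw //; apply: eq_sw => b1' b2'.
rewrite /braiding sw_sw // sw_sw; last by lin.
by apply: eq_sw => r s; rewrite !sw_tens //; lin.
Qed.

Lemma br_antipodel U (F : B -> U) b : linear F ->
  \sw_(b1, b2 <- Delta b) F (S b1 * b2) = eps b *: F 1.
Proof.
move=> lF; rewrite -(linear_funZ _ _ lF) -(antipode_l (br_antipode B)).
by rewrite (linear_of_sw _ _ lF).
Qed.
Lemma br_antipoder U (F : B -> U) b : linear F ->
  \sw_(b1, b2 <- Delta b) F (b1 * S b2) = eps b *: F 1.
Proof.
move=> lF; rewrite -(linear_funZ _ _ lF) -(antipode_r (br_antipode B)).
by rewrite (linear_of_sw _ _ lF).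
Qed.

Lemma br_eps_mul b b' : eps (b * b') = eps b * eps b'.
Proof. by rewrite (br_epsM B).2. Qed.
Lemma br_eps_one : eps 1 = 1.
Proof. by rewrite (br_epsM B).1. Qed.

Lemma br_S1 : S 1 = 1.
Proof.
have := @br_antipodel _ id 1 (fun _ _ _ => erefl).
by rewrite br_Delta1 algone_sw ?mulr1 ?br_eps_one ?scale1r //; lin.
Qed.

(** In the convolution algebra of maps from the braided coalgebra B ⊗ B to B, the
    map S(b b') is a left inverse of the product b b'. *)
Lemma br_conv_S_mul b b' :
  \sw_(b1, b2 <- Delta b) \sw_(b1', b2' <- Delta b') \sw_(r, s <- R)
     S (b1 * (s ▷ b1')) * ((r ▷ b2) * b2') = eps b *: (eps b' *: (1 : B)).
Proof.
rewrite scalerA -br_eps_mul -(@br_antipodel _ id) // br_Delta_mul //; lin.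
Qed.

(** In the same convolution algebra, the product of the antipodes after the
    braiding is a right inverse of b b': the two copies of R combine by the
    hexagon identity, and the resulting action on b'_(1) S(b'_(2)) is by a
    counit. *)
Lemma br_conv_mul_SS b b' :
  \sw_(b1, b2 <- Delta b) \sw_(b1', b2' <- Delta b') \sw_(r, s <- R)
     (b1 * (s ▷ b1')) * (\sw_(r', s' <- R) S (s' ▷ b2') * S (r' ▷ (r ▷ b2)))
  = eps b *: (eps b' *: (1 : B)).
Proof.
lhs rewrite mul_swr.
lhs rewrite -br_actM.
exch 2.
lhsfold <- (@R_hexagonr) (fun r s r' s' => abs3 (r * r') s' s).
lhs rewrite br_act_S -!mulrA.
lhsfold1 <- (@br_act_mul_sw) (fun x y => rewrite (mulrA (x ▷ _)); absmul).
exch 1.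
lhsfold1 (@br_antipoder) (fun x y => absmul).
lhs rewrite br_act_one alg_scaleAl mul1r alg_scaleAr scalerA mulrC -scalerA.
lhs rewrite (R_epsr (F := fun r => eps b' *: (_ * S (r ▷ _)))).
lhs rewrite br_act1.
lhsfold1 (@br_antipoder) (fun x y => absmul).
by [].
Qed.

(** The antipode is anti-multiplicative up to the braiding: a left and a right
    inverse of b b' coincide. The associativity of the convolution product on
    B ⊗ B is checked by bringing both bracketings to a common form, in terms of
    threefold coproducts of b and b'. *)
Lemma br_S_mul b b' :
  S (b * b') = \sw_(r, s <- R) S (s ▷ b') * S (r ▷ b).
Proof.
(* S(b b') convolved with the unit, written by [br_conv_mul_SS]. *)
transitivity (\sw_(b1, b2 <- Delta b) \sw_(b1', b2' <- Delta b') \sw_(r, s <- R)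
   S (b1 * (s ▷ b1')) *
     \sw_(x1, x2 <- Delta (r ▷ b2)) \sw_(y1, y2 <- Delta b2') \sw_(r1, s1 <- R)
      (x1 * (s1 ▷ y1)) * (\sw_(r', s' <- R) S (s' ▷ y2) * S (r' ▷ (r1 ▷ x2)))).
  rhs rewrite br_conv_mul_SS.
  rhs rewrite !alg_scaleAr mulr1 br_act_eps.
  rhs rewrite -scalerA.
  rhs rewrite (R_epsl (F := fun s => _)).
  rhs rewrite br_act1.
  rhs rewrite (scalerA _ _ (S _)) mulrC -scalerA.
  rhs rewrite (counitr_sw (br_coalgebra B)).
  by rhs rewrite (counitr_sw (br_coalgebra B)).
(* The common form. *)
transitivity (\sw_(b1, x <- Delta b) \sw_(b2, b3 <- Delta x)
    \sw_(b1', y <- Delta b') \sw_(b2', b3' <- Delta y)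
    \sw_(r, s <- R) \sw_(r1, s1 <- R) \sw_(r2, s2 <- R)
   S (b1 * ((s * s1) ▷ b1')) * (((r ▷ b2) * (s2 ▷ b2')) *
     (\sw_(r', s' <- R) S (s' ▷ b3') * S (r' ▷ ((r2 * r1) ▷ b3))))).
  do 3 lhs rewrite mul_swr.
  lhs rewrite br_Delta_act.
  lhs rewrite R_hexagonl.
  exch 3. exch 2. exch 1. exch 4. exch 3.
  by lhs rewrite -br_actM.
(* The other bracketing, where [br_conv_S_mul] applies. *)
symmetry.
transitivity (\sw_(b1, b2 <- Delta b) \sw_(b1', b2' <- Delta b') \sw_(r, s <- R)
   (\sw_(x1, x2 <- Delta b1) \sw_(y1, y2 <- Delta (s ▷ b1')) \sw_(r1, s1 <- R)
      S (x1 * (s1 ▷ y1)) * ((r1 ▷ x2) * y2)) *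
     \sw_(r', s' <- R) S (s' ▷ b2') * S (r' ▷ (r ▷ b2))).
  rhs rewrite br_conv_S_mul.
  rhs rewrite br_act_eps !alg_scaleAl mul1r.
  rhs rewrite -scalerA.
  rhs rewrite (scalerA (eps _)) mulrC -scalerA.
  rhs rewrite (R_epsr (F := fun r => _)).
  rhs rewrite br_act1.
  rhs rewrite (scalerA (eps _)) mulrC -scalerA.
  rhs rewrite (counitl_sw (br_coalgebra B)).
  by rhs rewrite (counitl_sw (br_coalgebra B)).
do 3 lhs rewrite mul_swl.
lhs rewrite br_Delta_act.
exch 3.
lhs rewrite R_hexagonr.
exch 3. exch 2. exch 1. exch 4. exch 3.
lhs rewrite (coassoc_sw (br_coalgebra B)).
lhsat 2 rewrite (coassoc_sw (br_coalgebra B)).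
exch 4. exch 5. exch 4.
by lhs rewrite -!br_actM -mulrA.
Qed.

Lemma br_S_mul_sw U (F : B -> U) b b' : linear F ->
  F (S (b * b')) = \sw_(r, s <- R) F ((s ▷ S b') * (r ▷ S b)).
Proof.
by move=> lF; rewrite br_S_mul (linear_of_sw _ _ lF); apply: eq_sw => r s; rewrite !br_act_S.
Qed.
End BraidedHopf.

(** * Comodule algebras and the induced action *)

Section ComoduleAlgebra.
Variables (k : fieldType) (H : qtHopf k) (C : brHopf H) (A : comodAlg C).
Local Notation DeltaH := (qt_Delta H).
Local Notation epsH := (qt_eps H).
Local Notation R := (qt_R H).
Local Notation Delta := (br_Delta _).
Local Notation coact := (comod_coact A).
Implicit Types (U : lmodType k) (g h : H) (a : A).

Lemma comod_act1 a : 1 ▶ a = a.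
Proof. by rewrite (module_act1 (modalg_module (comod_module_algebra A))). Qed.
Lemma comod_actM g h a : (g * h) ▶ a = g ▶ (h ▶ a).
Proof. by rewrite (module_actM (modalg_module (comod_module_algebra A))). Qed.
Lemma comod_act_mul h a a' : h ▶ (a * a') = \sw_(h1, h2 <- DeltaH h) (h1 ▶ a) * (h2 ▶ a').
Proof. exact: (modalg_actM (comod_module_algebra A)). Qed.
Lemma comod_act_one h : h ▶ 1 = epsH h *: (1 : A).
Proof. exact: (modalg_act1 (comod_module_algebra A)). Qed.

Lemma comod_coact_act U (F : A -> C -> U) h a : bilinear2 F ->
  sweedler (coact (h ▶ a)) F =
  \sw_(h1, h2 <- DeltaH h) \sw_(a0, c <- coact a) F (h1 ▶ a0) (h2 ▷ c).
Proof. by move=> bF; rewrite comod_act_coact sw2_sw2. Qed.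

Lemma comod_coact_mul U (F : A -> C -> U) a a' : bilinear2 F ->
  sweedler (coact (a * a')) F =
  \sw_(a0, c <- coact a) \sw_(a0', c' <- coact a') \sw_(r, s <- R)
    F (a0 * (s ▶ a0')) ((r ▷ c) * c').
Proof.
move=> bF; rewrite comod_coactM sw_sw //; apply: eq_sw => b1 b2.
rewrite sw_sw //; apply: eq_sw => b1' b2'.
rewrite /braiding sw_sw // sw_sw; last by lin.
by apply: eq_sw => r s; rewrite !sw_tens //; lin.
Qed.

Lemma comod_coassoc_sw U (F : A -> C -> C -> U) a : trilinear F ->
  \sw_(a0, c <- coact a) \sw_(a00, c' <- coact a0) F a00 c' c =
  \sw_(a0, c <- coact a) \sw_(c1, c2 <- Delta c) F a0 c1 c2.
Proof. by move=> lF; apply: (sw_eq3 lF (comod_coassoc a)). Qed.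

Lemma comod_counit_sw U (F : A -> U) a : linear F ->
  \sw_(a0, c <- coact a) br_eps C c *: F a0 = F a.
Proof.
move=> lF; rewrite -[in RHS](comod_counit a) (linear_of_sw _ _ lF).
by apply: eq_sw => x y; rewrite (linear_funZ _ _ lF).
Qed.
End ComoduleAlgebra.

Section Pairing.
Variables (k : fieldType) (H : qtHopf k) (C B : brHopf H) (ev : weakDuality C B).
Local Notation DeltaH := (qt_Delta H).
Local Notation epsH := (qt_eps H).
Local Notation Delta := (br_Delta _).
Implicit Types (U : lmodType k).

Lemma ev_scaler c b x : ev c (x *: b) = x * ev c b.
Proof. by rewrite linearZr_LR. Qed.
Lemma ev_act U (x : U) h c b :
  \sw_(h1, h2 <- DeltaH h) ev (h1 ▷ c) (h2 ▷ b) *: x = (epsH h * ev c b) *: x.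
Proof. by rewrite -scale_swl wd_act. Qed.
Lemma ev_mulr U (x : U) c b b' :
  ev c (b * b') *: x = \sw_(c1, c2 <- Delta c) ev c2 b *: (ev c1 b' *: x).
Proof. by rewrite wd_mulr scale_swl; apply: eq_sw => b1 b2; rewrite scalerA. Qed.
End Pairing.

Section InducedAction.
Variables (k : fieldType) (H : qtHopf k) (C B : brHopf H) (ev : weakDuality C B).
Variable A : comodAlg C.
Local Notation DeltaH := (qt_Delta H).
Local Notation R := (qt_R H).
Local Notation S := (br_S _).
Local Notation coact := (comod_coact A).
Local Notation phi := (induced_action ev (A := A)).
Implicit Types (U : lmodType k) (g h : H) (a : A) (b : B).

Lemma induced_actionE b a : phi b a =
  \sw_(r, s <- R) \sw_(a0, c <- coact (s ▶ a)) ev c (r ▷ S b) *: a0.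
Proof.
rewrite /induced_action /braiding sw_sw; last by lin.
by apply: eq_sw => r s; rewrite sw_tens //; lin.
Qed.

Lemma induced_action_sw U (F : A -> U) b a : linear F -> F (phi b a) =
  \sw_(r, s <- R) \sw_(a0, c <- coact (s ▶ a)) ev c (r ▷ S b) *: F a0.
Proof.
move=> lF; rewrite induced_actionE (linear_of_sw _ _ lF).
apply: eq_sw => r s; rewrite (linear_of_sw _ _ lF).
by apply: eq_sw => a0 c; rewrite (linear_funZ _ _ lF).
Qed.

Lemma induced_action_bilinear : bilinear2 phi.
Proof.
split=> [a|b] x u v; rewrite !induced_actionE.
  have : linear (fun b : B =>
      \sw_(r, s <- R) \sw_(a0, c <- coact (s ▶ a)) ev c (r ▷ S b) *: a0) by lin.
  exact.
have : linear (fun a : A =>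
    \sw_(r, s <- R) \sw_(a0, c <- coact (s ▶ a)) ev c (r ▷ S b) *: a0) by lin.
exact.
Qed.

(** By quasi-cocommutativity h moves past R; the part of it that then acts on
    both arguments of the pairing becomes a counit. *)
Lemma induced_action_act h b a :
  h ▶ phi b a = \sw_(h1, h2 <- DeltaH h) phi (h1 ▷ b) (h2 ▶ a).
Proof.
rewrite (induced_action_sw (F := fun x => h ▶ x)); last by lin.
rhs rewrite induced_actionE.
rhs rewrite br_act_S.
rhs rewrite -br_actM -comod_actM.
symmetry; exch 0.
lhsfold (@R_DeltaH) (fun r s h1 h2 => abs2 (r * h1) (s * h2)).
lhs rewrite comod_actM comod_coact_act.
lhs rewrite (coassoc_sw (bialg_coalgebra (qt_bialgebra H))).
exch 2.
lhs rewrite br_actM.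
lhs rewrite ev_act -scalerA.
exch 1.
lhs rewrite (counitr_sw (bialg_coalgebra (qt_bialgebra H))).
by [].
Qed.

Lemma induced_action_1 a : phi 1 a = a.
Proof.
rewrite induced_actionE br_S1.
lhs rewrite br_act_one.
lhs rewrite ev_scaler wd_1r -scalerA.
lhs rewrite -sw_scale.
lhs rewrite comod_counit.
rewrite -[RHS]comod_act1.
by lhs rewrite R_epsl.
Qed.

(** Both sides involve the twofold coaction on a, paired with S b and S b'. The
    anti-multiplicativity of S contributes an extra copy of R; the hexagon
    identity makes its second leg act, through the coproduct, on both arguments
    of one pairing, and the invariance of the pairing removes it. *)
Lemma induced_action_M b b' a : phi (b * b') a = phi b (phi b' a).
Proof.
rewrite (@induced_actionE b (phi b' a)).
rhs rewrite (induced_action_sw (F := fun x => \sw_(a0, c <- coact (_ ▶ x)) _)).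
rhs rewrite sw_scale.
rhsat 3 rewrite comod_coact_act.
symmetry; exch 2; symmetry.
rhs rewrite comod_coassoc_sw.
rewrite induced_actionE.
lhs rewrite (br_S_mul_sw (F := fun x => ev _ (_ ▷ x) *: _)).
lhs rewrite (br_act_mul_sw (F := fun x => ev _ x *: _)).
exch 1. exch 2. exch 0.
lhs rewrite -!br_actM.
exch 0.
(* The copy of R coming from the antipode moves to the left of the one that
   acts on S(b b'). *)
lhsfold <- (@R_DeltaH) (fun r s h1 h2 => abs2 (h2 * r) (h1 * s)).
exch 1.
lhs rewrite R_hexagonl.
lhs rewrite comod_actM.
lhs rewrite comod_coact_act.
lhs rewrite ev_mulr.
lhs rewrite br_Delta_act.
exch 4.
lhs rewrite -(coassoc_sw (bialg_coalgebra (qt_bialgebra H))).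
exch 2. exch 1.
lhs rewrite R_hexagonr.
exch 2. exch 1. exch 0.
lhs rewrite mulrA.
(* The extra copy joins the one acting on the second factor of the coproduct
   of c: their common leg acts on both arguments of the pairing with S b'. *)
lhsfold <- (@R_hexagonr) (fun r s r' s' => abs3 (r * r') s' s).
lhs rewrite [X in ev _ X *: (ev _ _ *: _)]br_actM.
exch 1. exch 2. exch 3. exch 4. exch 5.
lhs rewrite ev_act -scalerA.
exch 0. exch 1. exch 2. exch 3. exch 4.
lhs rewrite R_epsr.
by lhs rewrite mul1r.
Qed.
End InducedAction.

(** * Exchanging A and B with and without the antipode *)

Section Exchange.
Variables (k : fieldType) (H : qtHopf k) (C B : brHopf H) (ev : weakDuality C B).
Variable A : comodAlg C.
Local Notation R := (qt_R H).
Local Notation Rinv := (qt_Rinv H).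
Local Notation Delta := (br_Delta _).
Local Notation S := (br_S _).
Local Notation coact := (comod_coact A).
Variables (U : lmodType k) (M : A -> B -> U) (N : B -> A -> U).
Hypotheses (bilM : bilinear2 M) (bilN : bilinear2 N).

(** M and N stand for the products a b and b a. Substituting the relation into
    the right-hand side, R and R^-1 cancel and the pairings combine to ev(c,
    b_(1) S(b_(2))), a counit. *)
Lemma cross_BA_AB :
  (forall b a, N b a = \sw_(r, s <- R) \sw_(a0, c <- coact (s ▶ a))
      \sw_(b1, b2 <- Delta (r ▷ b)) ev c (S b1) *: M a0 b2) ->
  forall a b, M a b = \sw_(b1, b2 <- Delta b) \sw_(a0, c <- coact a)
    \sw_(p, q <- Rinv) ev c b1 *: N (p ▷ b2) (q ▶ a0).
Proof.
move=> NE a b; symmetry.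
lhs rewrite NE.
do 3 lhs rewrite sw_scale.
lhs rewrite -br_actM.
lhs rewrite -comod_actM.
exch 2.
lhsfold (@R_Rinv) (fun p q r s => abs2 (p * r) (q * s)).
lhs rewrite comod_act1.
lhs rewrite br_act1.
lhs rewrite comod_coassoc_sw.
exch 2. exch 1.
lhs rewrite -ev_mulr.
lhs rewrite -(coassoc_sw (br_coalgebra B)).
exch 1.
lhsfold1 (@br_antipoder) (fun x y => absmul).
exch 0.
lhs rewrite (counitl_sw (br_coalgebra B)) wd_1r.
exact: comod_counit_sw (bilM.1 b).
Qed.

(** The same cancellation in the other order, now with ev(c, S(b_(1)) b_(2)). *)
Lemma cross_AB_BA :
  (forall a b, M a b = \sw_(b1, b2 <- Delta b) \sw_(a0, c <- coact a)
    \sw_(p, q <- Rinv) ev c b1 *: N (p ▷ b2) (q ▶ a0)) ->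
  forall b a, N b a = \sw_(r, s <- R) \sw_(a0, c <- coact (s ▶ a))
      \sw_(b1, b2 <- Delta (r ▷ b)) ev c (S b1) *: M a0 b2.
Proof.
move=> ME b a; symmetry.
lhs rewrite ME.
do 3 lhs rewrite sw_scale.
exch 3. exch 2.
lhs rewrite comod_coassoc_sw.
exch 2. exch 3. exch 4.
lhs rewrite -ev_mulr.
lhs rewrite -(coassoc_sw (br_coalgebra B)).
exch 3.
lhsfold1 (@br_antipodel) (fun x y => absmul).
exch 2.
lhs rewrite (counitl_sw (br_coalgebra B)).
lhs rewrite wd_1r.
exch 1.
lhs rewrite comod_counit_sw.
exch 0.
lhs rewrite -br_actM -comod_actM.
lhsfold (@Rinv_R) (fun p q r s => abs2 (p * r) (q * s)).
by rewrite br_act1 comod_act1.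
Qed.
End Exchange.

(** * The universal property of the triple product *)

Section TripleProduct.
Variables (k : fieldType) (H : qtHopf k) (C B : brHopf H) (ev : weakDuality C B).
Variable A : comodAlg C.
Variable P : tripleProduct ev A.
Local Notation DeltaH := (qt_Delta H).
Local Notation R := (qt_R H).
Local Notation Rinv := (qt_Rinv H).
Local Notation Delta := (br_Delta _).
Local Notation S := (br_S _).
Local Notation coact := (comod_coact A).
Local Notation tA := (tp_A P).
Local Notation tB := (tp_B P).
Local Notation tH := (tp_H P).

(** The form of the commutation relation that is transported to D ⊗ P. *)
Lemma tp_AB a b : tA a * tB b =
  \sw_(b1, b2 <- Delta b) \sw_(a0, c <- coact a) \sw_(p, q <- Rinv)
     ev c b1 *: (tB (p ▷ b2) * tA (q ▶ a0)).
Proof.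
apply: (cross_BA_AB (M := fun a b => tA a * tB b) (N := fun b a => tB b * tA a)); [lin|].
by move=> {}b {}a; apply: tp_BA.
Qed.

(** The products a b h span. *)
Lemma tp_linear_eq (X : lmodType k) (f g : P -> X) : linear f -> linear g ->
  (forall a b h, f (tA a * tB b * tH h) = g (tA a * tB b * tH h)) -> f =1 g.
Proof.
move=> lf lg fg x; have [t _ tK] := tp_bij P.
rewrite -[x]tK (linear_of_sw _ _ lf) (linear_of_sw _ _ lg).
apply: eq_sw => a u; rewrite (linear_of_sw _ _ lf) (linear_of_sw _ _ lg).
by apply: eq_sw => b h.
Qed.

Section Lift.
Variables (X : pzAlgType k) (jA : {linear A -> X}) (jB : {linear B -> X}) (jH : {linear H -> X}).
Hypotheses (jA_mor : monoid_morphism jA) (jB_mor : monoid_morphism jB)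
  (jH_mor : monoid_morphism jH).
Hypothesis jBA : forall b a, jB b * jA a =
    \sw_(r, s <- R) \sw_(a0, c <- coact (s ▶ a)) \sw_(b1, b2 <- Delta (r ▷ b))
        ev c (S b1) *: (jA a0 * jB b2).
Hypothesis jHA : forall h a,
    jH h * jA a = \sw_(h1, h2 <- DeltaH h) jA (h1 ▶ a) * jH h2.
Hypothesis jHB : forall h b,
    jH h * jB b = \sw_(h1, h2 <- DeltaH h) jB (h1 ▷ b) * jH h2.

Lemma tp_lift_linear : exists f : {linear P -> X},
  forall a b h, f (tA a * tB b * tH h) = jA a * jB b * jH h.
Proof.
have [g gK Kg] := tp_bij P.
pose f x := \sw_(a, u <- g x) \sw_(b, h <- u) jA a * jB b * jH h.
have lg : linear g.
  move=> a x y; apply: (can_inj gK); rewrite Kg.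
  pose Phi (t : A ⊗ (B ⊗ H)) : P := \sw_(a, u <- t) \sw_(b, h <- u) tA a * tB b * tH h.
  have lPhi : linear Phi by rewrite /Phi; lin.
  by rewrite -[RHS]/(Phi _) lPhi /Phi !Kg.
have lf : linear f by rewrite /f; lin.
pose fL : {linear P -> X} := HB.pack f (GRing.isLinear.Build k P X *:%R f lf).
exists fL.
move=> a b h /=; rewrite /f.
have -> : g (tA a * tB b * tH h) = a ⊠ (b ⊠ h).
  by apply: (can_inj gK); rewrite Kg sw_tens ?sw_tens //; lin.
by rewrite sw_tens ?sw_tens //; lin.
Qed.

(** The linear map f with f(a b h) = jA(a) jB(b) jH(h) commutes with left
    multiplication by A, then by B and by H, because the relations that reorder
    b (a' b' h') and h (a' b' h') hold in X as well; these elements generate. *)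
Lemma tp_lift : exists f : {linear P -> X},
  [/\ monoid_morphism f, forall a, f (tA a) = jA a, forall b, f (tB b) = jB b
    & forall h, f (tH h) = jH h].
Proof.
have [f fE] := tp_lift_linear.
have fA a y : f (tA a * y) = jA a * f y.
  move: y; apply: tp_linear_eq => [||a' b h]; [lin | lin |].
  by rewrite !mulrA -(tp_Amorph P).2 !fE jA_mor.2 -!mulrA.
have fB b y : f (tB b * y) = jB b * f y.
  move: y; apply: tp_linear_eq => [||a b' h]; [lin | lin |].
  rewrite fE !mulrA jBA tp_BA.
  rewrite -!mulrA !mul_swl (linear_of_sw _ _ (linear_bundled f)).
  apply: eq_sw => r s; rewrite !mul_swl (linear_of_sw _ _ (linear_bundled f)).
  apply: eq_sw => a0 c; rewrite !mul_swl (linear_of_sw _ _ (linear_bundled f)).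
  apply: eq_sw => b1 b2; rewrite !alg_scaleAl linearZ /=; congr (_ *: _).
  by rewrite mulrA -(mulrA (tA a0)) -(tp_Bmorph P).2 fE jB_mor.2 !mulrA.
have fBH b h : f (tB b * tH h) = jB b * jH h.
  by rewrite -[tB b]mul1r -(tp_Amorph P).1 fE jA_mor.1 mul1r.
have fH1 h : f (tH h) = jH h.
  by rewrite -[tH h]mul1r -(tp_Bmorph P).1 fBH jB_mor.1 mul1r.
have fHB h b h' : f (tH h * (tB b * tH h')) = jH h * (jB b * jH h').
  rewrite !mulrA jHB tp_HB !mul_swl (linear_of_sw _ _ (linear_bundled f)).
  apply: eq_sw => h1 h2.
  by rewrite -!mulrA -(tp_Hmorph P).2 fBH jH_mor.2.
have fH h y : f (tH h * y) = jH h * f y.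
  move: y; apply: tp_linear_eq => [||a b h']; [lin | lin |].
  rewrite fE -!mulrA [tH h * _]mulrA [jH h * _]mulrA jHA tp_HA !mul_swl.
  rewrite (linear_of_sw _ _ (linear_bundled f)).
  apply: eq_sw => h1 h2.
  by rewrite -!mulrA fA fHB.
have f1 : f 1 = 1 by rewrite -(tp_Hmorph P).1 fH1 jH_mor.1.
exists f; split=> // [|a|b].
- split=> // x y; move: x; apply: tp_linear_eq => [||a b h]; [lin | lin |].
  by rewrite fE -!mulrA fA fB fH.
- by rewrite -[tA a]mulr1 fA f1 mulr1.
- by rewrite -[tB b]mulr1 fB f1 mulr1.
Qed.
End Lift.

Lemma tp_morphism_eq (X : pzAlgType k) (f g : {linear P -> X}) :
  monoid_morphism f -> monoid_morphism g ->
  (forall a, f (tA a) = g (tA a)) -> (forall b, f (tB b) = g (tB b)) ->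
  (forall h, f (tH h) = g (tH h)) -> f =1 g.
Proof.
move=> fM gM fgA fgB fgH; apply: tp_linear_eq => [||a b h]; [lin | lin |].
by rewrite !fM.2 !gM.2 fgA fgB fgH.
Qed.
End TripleProduct.

(** * The coaction *)

(** Coassociativity and counitality compare maps of this form composed with the
    coaction. *)
Lemma sw_monoid_morphism (k : fieldType) (D P X : pzAlgType k) (F : D -> P -> X) :
  bilinear2 F -> F 1 1 = 1 ->
  (forall d y d' y', F (d * d') (y * y') = F d y * F d' y') ->
  monoid_morphism (fun t : D ⊗ P => sweedler t F).
Proof.
move=> bF F1 FM; split=> [|t u]; first by rewrite algone_sw.
rewrite algM_sw // mul_swl; apply: eq_sw => d y; rewrite mul_swr.
by apply: eq_sw => d' y'; apply: FM.
Qed.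

Section Coaction.
Variables (k : fieldType) (H : qtHopf k) (C B : brHopf H) (ev : weakDuality C B).
Variables (A : comodAlg C) (D : drinDouble ev) (P : tripleProduct ev A).
Local Notation DeltaH := (qt_Delta H).
Local Notation R := (qt_R H).
Local Notation Rinv := (qt_Rinv H).
Local Notation Delta := (br_Delta _).
Local Notation S := (br_S _).
Local Notation coact := (comod_coact A).
Local Notation tA := (tp_A P).
Local Notation tB := (tp_B P).
Local Notation tH := (tp_H P).
Local Notation dC := (dd_C D).
Local Notation dB := (dd_B D).
Local Notation dH := (dd_H D).
Local Notation rel := (dd_relations D).
Local Notation DeltaD := (dd_Delta D).
Local Notation in_AB := (@in_AB _ _ _ _ _ _ P).
Local Notation coH := (bialg_coalgebra (qt_bialgebra H)).
Implicit Types U : lmodType k.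

Lemma dH_mul g h : dH (g * h) = dH g * dH h. Proof. exact: (drin_jH rel).2. Qed.
Lemma dB_mul b b' : dB (b * b') = dB b * dB b'. Proof. exact: (drin_jB rel).2. Qed.
Lemma dC_mul c c' : dC (c * c') = dC c * dC c'. Proof. exact: (drin_jC rel).2. Qed.
Lemma tH_mul g h : tH (g * h) = tH g * tH h. Proof. exact: (tp_Hmorph P).2. Qed.
Lemma tB_mul b b' : tB (b * b') = tB b * tB b'. Proof. exact: (tp_Bmorph P).2. Qed.
Lemma tA_mul a a' : tA (a * a') = tA a * tA a'. Proof. exact: (tp_Amorph P).2. Qed.
Lemma dH_dB h b y :
  dH h * (dB b * y) = \sw_(h1, h2 <- DeltaH h) dB (h1 ▷ b) * (dH h2 * y).
Proof.
rewrite mulrA (drin_HB rel) mul_swl.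
by apply: eq_sw => h1 h2; rewrite mulrA.
Qed.
Lemma dH_dC h c y :
  dH h * (dC c * y) = \sw_(h1, h2 <- DeltaH h) dC (h1 ▷ c) * (dH h2 * y).
Proof.
rewrite mulrA (drin_HC rel) mul_swl.
by apply: eq_sw => h1 h2; rewrite mulrA.
Qed.

Definition coactA (a : A) : D ⊗ P :=
  \sw_(p, q <- Rinv) \sw_(a0, c <- coact a) (dH p * dC c) ⊠ tA (q ▶ a0).
Definition coactB (b : B) : D ⊗ P :=
  \sw_(b1, b2 <- Delta b) \sw_(r, s <- R) (dB b1 * dH s) ⊠ tB (r ▷ b2).
Definition coactH (h : H) : D ⊗ P := \sw_(h1, h2 <- DeltaH h) dH h1 ⊠ tH h2.

Lemma coactA_linear : linear coactA. Proof. by rewrite /coactA; lin. Qed.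
Lemma coactB_linear : linear coactB. Proof. by rewrite /coactB; lin. Qed.
Lemma coactH_linear : linear coactH. Proof. by rewrite /coactH; lin. Qed.

(** The coaction of C on A is multiplicative up to the braiding. Moving p past
    the C-component of a produces a copy of R^-1 that cancels that braiding. *)
Lemma coactA_mul a a' : coactA (a * a') = coactA a * coactA a'.
Proof.
rewrite /coactA.
do 2 rhs rewrite mul_swl.
do 2 rhs rewrite mul_swr.
rhs rewrite tens_mul -!mulrA.
lhs rewrite comod_coact_mul.
lhs rewrite dC_mul comod_act_mul bundled_sw tens_swr.
lhs rewrite tA_mul.
exch 3. exch 2. exch 1.
lhs rewrite Rinv_hexagonr.
lhs rewrite dH_mul -!mulrA.
lhs rewrite dH_dC.
lhs rewrite mul_swr.
lhs rewrite tens_swl.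
exch 4. exch 3. exch 2.
lhs rewrite Rinv_hexagonl.
lhs rewrite -br_actM -comod_actM.
exch 1. exch 2. exch 3.
(* The braiding of the C-component of a with a' cancels. *)
lhsfold (@Rinv_R) (fun p q r s => rewrite -!mulrA; abs2 (p * r) (q * s)).
exch 1.
by lhs rewrite br_act1 mulr1.
Qed.

(** Moving s past b'_(1) produces, by the hexagon identity, the copy of R that
    braids b_(2) with b'_(1) in the coproduct of b b'. *)
Lemma coactB_mul b b' : coactB (b * b') = coactB b * coactB b'.
Proof.
rewrite /coactB.
do 2 rhs rewrite mul_swl.
do 2 rhs rewrite mul_swr.
rhs rewrite tens_mul -!mulrA.
rhs rewrite dH_dB.
rhs rewrite mul_swr.
rhs rewrite tens_swl.
symmetry; exch 3; exch 2; symmetry.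
rhs rewrite R_hexagonr.
lhs rewrite br_Delta_mul.
lhs rewrite dB_mul.
lhs rewrite br_act_mul bundled_sw tens_swr.
lhs rewrite tB_mul.
lhs rewrite R_hexagonl.
exch 2. exch 1. exch 2.
by lhs rewrite -br_actM dH_mul -!mulrA.
Qed.

Lemma coactHA h a :
  coactH h * coactA a = \sw_(h1, h2 <- DeltaH h) coactA (h1 ▶ a) * coactH h2.
Proof.
rewrite /coactA /coactH.
lhs rewrite mul_swl.
do 2 lhs rewrite mul_swr.
lhs rewrite tens_mul tp_HA tens_swr.
lhs rewrite -comod_actM mulrA -dH_mul.
exch 2. exch 1.
lhs rewrite -(coassoc_sw coH).
lhsfold (@Rinv_DeltaH) (fun h1 h2 p q => abs2 (h1 * p) (h2 * q)).
lhs rewrite dH_mul -!mulrA (drin_HC rel) mul_swr tens_swl.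
exch 3. exch 2.
lhsat 1 rewrite -(coassoc_sw coH).
lhs rewrite (coassoc_sw coH).
exch 1. exch 2. exch 1. exch 3.
do 2 rhs rewrite mul_swl.
rhs rewrite mul_swr.
rhs rewrite comod_coact_act.
by rhs rewrite tens_mul -!mulrA -comod_actM.
Qed.

Lemma coactHB h b :
  coactH h * coactB b = \sw_(h1, h2 <- DeltaH h) coactB (h1 ▷ b) * coactH h2.
Proof.
rewrite /coactB /coactH.
lhs rewrite mul_swl.
do 2 lhs rewrite mul_swr.
lhs rewrite tens_mul tp_HB tens_swr.
lhs rewrite dH_dB tens_swl.
lhs rewrite -br_actM -dH_mul.
exch 3. exch 2. exch 1. exch 3. exch 2.
lhs rewrite (coassoc_sw coH).
lhsat 1 rewrite -(coassoc_sw coH).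
exch 3. exch 2.
lhsfold <- (@R_DeltaH) (fun r s h1 h2 => abs2 (h2 * r) (h1 * s)).
do 2 rhs rewrite mul_swl.
rhs rewrite mul_swr.
rhs rewrite tens_mul -!mulrA -dH_mul.
rhs rewrite br_Delta_act.
rhs rewrite -br_actM.
symmetry.
exch 3. exch 2.
lhs rewrite (coassoc_sw coH).
lhsat 1 rewrite -(coassoc_sw coH).
exch 3. exch 2.
by [].
Qed.

Lemma coactH_mul g h : coactH (g * h) = coactH g * coactH h.
Proof.
rewrite /coactH DeltaM_sw; last by lin.
rhs rewrite mul_swl.
rhs rewrite mul_swr.
by rhs rewrite tens_mul -dH_mul -tH_mul.
Qed.

Lemma coactA_1 : coactA 1 = 1.
Proof.
rewrite /coactA.
lhs rewrite comod_coact1 sw_tens.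
lhs rewrite comod_act_one linearZ /= tens_scaler.
rewrite Rinv_epsr; last by lin.
by rewrite (drin_jH rel).1 (drin_jC rel).1 (tp_Amorph P).1 mulr1.
Qed.

Lemma coactB_1 : coactB 1 = 1.
Proof.
rewrite /coactB br_Delta1 algone_sw; last by lin.
lhs rewrite br_act_one linearZ /= tens_scaler.
rewrite R_epsl; last by lin.
by rewrite (drin_jH rel).1 (drin_jB rel).1 (tp_Bmorph P).1 mulr1.
Qed.

Lemma coactH_1 : coactH 1 = 1.
Proof.
rewrite /coactH Delta1_sw; last by lin.
by rewrite (drin_jH rel).1 (tp_Hmorph P).1.
Qed.

(** The cross relation of the double inside a product, below a linear map. *)
Lemma drin_cross_mul U (G : D -> U) b c (y : D) : linear G ->
  \sw_(b1, b2 <- Delta b) \sw_(c1, c2 <- Delta c)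
    \sw_(p, q <- Rinv) \sw_(r, s <- R)
      ev (q ▷ c1) (r ▷ b2) *: G (dH p * (dC c2 * (dB b1 * (dH s * y)))) =
  \sw_(b1, b2 <- Delta b) \sw_(c1, c2 <- Delta c) \sw_(p, q <- Rinv)
      ev c2 b1 *: G (dB (p ▷ b2) * (dC (q ▷ c1) * y)).
Proof.
move=> lG.
have E := congr1 (fun x : D => G (x * y)) (drin_cross rel b c).
symmetry; apply: etrans (etrans _ E) _.
  do 3 rhs rewrite mul_swl (linear_of_sw _ _ lG).
  by rhs rewrite alg_scaleAl (linear_funZ _ _ lG) -!mulrA.
do 4 lhs rewrite mul_swl (linear_of_sw _ _ lG).
by lhs rewrite alg_scaleAl (linear_funZ _ _ lG) -!mulrA.
Qed.

(** In the second factor A and B are exchanged by [tp_AB], in the first one B and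
    C by the cross relation of the double. Once the elements of the double are
    ordered as B, C, H, the two sides are those of [R_cross], acting on b_(2),
    c_(1), b_(3) and a^(0). *)
Lemma coactAB a b : coactA a * coactB b =
  \sw_(b1, b2 <- Delta b) \sw_(a0, c <- coact a) \sw_(p, q <- Rinv)
     ev c b1 *: (coactB (p ▷ b2) * coactA (q ▶ a0)).
Proof.
rewrite /coactA /coactB.
do 2 lhs rewrite mul_swl.
do 2 lhs rewrite mul_swr.
lhs rewrite tens_mul tp_AB tens_swr.
do 2 lhs rewrite tens_swr.
lhs rewrite tens_scaler.
(* The coproduct of b and the coaction on a are iterated; one copy of R and one
   of R^-1 are set apart for the cross relation of the double. *)
lhs rewrite br_Delta_act.
lhs rewrite comod_coact_act.
lhs rewrite R_hexagonl.
exch 5. exch 4. exch 3. exch 2. exch 1.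
lhs rewrite Rinv_hexagonr.
exch 6. exch 5. exch 4. exch 3.
lhs rewrite comod_coassoc_sw.
exch 6. exch 5.
lhs rewrite -(coassoc_sw (br_coalgebra B)).
exch 6. exch 5. exch 4. exch 3. exch 2. exch 1.
exch 7. exch 6. exch 5. exch 4. exch 3. exch 2.
exch 3. exch 4. exch 5. exch 6.
exch 4. exch 5.
(* The sums of the cross relation are now the innermost ones. *)
lhsat 9 rewrite !dH_mul -!mulrA.
lhs rewrite (drin_cross_mul (G := fun E => (_ * E) ⊠ _)).
(* The leading p moves to the right of B and C. *)
lhs rewrite dH_dB tens_swl sw_scale.
lhs rewrite dH_dC mul_swr tens_swl sw_scale.
exch 2. exch 1. exch 0.
exch 3. exch 2. exch 1.
exch 4. exch 3. exch 2.
exch 5. exch 4. exch 3.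
exch 7. exch 6. exch 5.
exch 8. exch 7. exch 6.
lhsat 10 rewrite -!br_actM -dH_mul -comod_actM.
lhs rewrite (R_cross (F := fun x1 x2 x3 x4 x5 =>
   _ *: ((dB (x1 ▷ _) * (dC (x2 ▷ _) * dH x3)) ⊠ (tB (x4 ▷ _) * tA (x5 ▶ _))))).
(* The right-hand side takes the shape of the right-hand side of [R_cross]. *)
symmetry.
do 2 lhs rewrite mul_swl sw_scale.
do 2 lhs rewrite mul_swr sw_scale.
lhs rewrite tens_mul.
lhs rewrite br_Delta_act.
lhs rewrite comod_coact_act.
exch 7. exch 6. exch 5. exch 4. exch 3. exch 2.
lhs rewrite comod_coassoc_sw.
exch 4. exch 3. exch 2. exch 1.
lhs rewrite -(coassoc_sw (br_coalgebra B)).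
exch 1. exch 0.
exch 7. exch 6.
lhs rewrite (drin_HC rel) mul_swr tens_swl sw_scale.
lhs rewrite -!mulrA dH_dC mul_swr tens_swl sw_scale.
exch 9.
by lhsat 11 rewrite -!br_actM -dH_mul -comod_actM -!mulrA.
Qed.
Lemma dd_Delta_mul U (F : D -> D -> U) x y : bilinear2 F ->
  sweedler (DeltaD (x * y)) F =
  \sw_(x1, x2 <- DeltaD x) \sw_(y1, y2 <- DeltaD y) F (x1 * y1) (x2 * y2).
Proof. by move=> bF; rewrite (bialg_DeltaM (dd_bialgebra D)).2 algM_sw. Qed.
Lemma dd_Delta_H U (F : D -> D -> U) h : bilinear2 F ->
  sweedler (DeltaD (dH h)) F = \sw_(h1, h2 <- DeltaH h) F (dH h1) (dH h2).
Proof.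
move=> bF; rewrite dd_DeltaH sw_sw //.
by apply: eq_sw => *; rewrite sw_tens.
Qed.
Lemma dd_Delta_B U (F : D -> D -> U) b : bilinear2 F ->
  sweedler (DeltaD (dB b)) F =
  \sw_(b1, b2 <- Delta b) \sw_(r, s <- R) F (dB b1 * dH s) (dB (r ▷ b2)).
Proof. by move=> bF; rewrite dd_DeltaB sw2_sw2. Qed.
Lemma dd_Delta_C U (F : D -> D -> U) c : bilinear2 F ->
  sweedler (DeltaD (dC c)) F =
  \sw_(c1, c2 <- Delta c) \sw_(p, q <- Rinv) F (dH p * dC c2) (dC (q ▷ c1)).
Proof. by move=> bF; rewrite dd_DeltaC sw2_sw2. Qed.

Lemma coactBA b a : coactB b * coactA a =
    \sw_(r, s <- R) \sw_(a0, c <- coact (s ▶ a)) \sw_(b1, b2 <- Delta (r ▷ b))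
        ev c (S b1) *: (coactA a0 * coactB b2).
Proof.
have lA := coactA_linear; have lB := coactB_linear.
move: b a; apply: (cross_AB_BA (M := fun a b => coactA a * coactB b)
  (N := fun b a => coactB b * coactA a)); [lin |].
exact: coactAB.
Qed.

(** On generators the coaction is prescribed; the lemmas above say that these
    values extend to an algebra morphism. *)
Lemma coaction_exists : exists delta : {linear P -> D ⊗ P},
  [/\ monoid_morphism delta, forall a, delta (tA a) = coactA a,
      forall b, delta (tB b) = coactB b & forall h, delta (tH h) = coactH h].
Proof.
pose cA : {linear A -> tensor D P} :=
  HB.pack coactA (GRing.isLinear.Build k A (tensor D P) *:%R coactA (coactA_linear)).
pose cB : {linear B -> tensor D P} :=
  HB.pack coactB (GRing.isLinear.Build k B (tensor D P) *:%R coactB (coactB_linear)).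
pose cH : {linear H -> tensor D P} :=
  HB.pack coactH (GRing.isLinear.Build k H (tensor D P) *:%R coactH (coactH_linear)).
apply: (@tp_lift _ _ _ _ _ _ P (tensor D P) cA cB cH).
- by split; [exact: coactA_1 | exact: coactA_mul].
- by split; [exact: coactB_1 | exact: coactB_mul].
- by split; [exact: coactH_1 | exact: coactH_mul].
- exact: coactBA.
- exact: coactHA.
- exact: coactHB.
Qed.

Section GivenCoaction.
Variable delta : {linear P -> D ⊗ P}.
Hypotheses (deltaM : monoid_morphism delta) (deltaA : forall a, delta (tA a) = coactA a)
  (deltaB : forall b, delta (tB b) = coactB b) (deltaH : forall h, delta (tH h) = coactH h).

Let coassl x := \sw_(d, y <- delta x) \sw_(d1, d2 <- DeltaD d) d1 ⊠ (d2 ⊠ y).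
Let coassr x := \sw_(d, y <- delta x) \sw_(d', y' <- delta y) d ⊠ (d' ⊠ y').

Lemma coassl_morphism : monoid_morphism coassl.
Proof.
have [] := @sw_monoid_morphism _ D P (tensor D (tensor D P))
  (fun d y => \sw_(d1, d2 <- DeltaD d) d1 ⊠ (d2 ⊠ y)).
- by lin.
- by rewrite (bialg_DeltaM (dd_bialgebra D)).1 algone_sw //; lin.
- move=> d y d' y'; rewrite dd_Delta_mul; last by lin.
  rhs rewrite mul_swl.
  rhs rewrite mul_swr.
  by rhs rewrite !tens_mul.
by move=> m1 mM; split=> [|x y]; rewrite /coassl ?deltaM.1 ?deltaM.2.
Qed.

Lemma coassr_morphism : monoid_morphism coassr.
Proof.
have [] := @sw_monoid_morphism _ D P (tensor D (tensor D P))
  (fun d y => \sw_(d', y' <- delta y) d ⊠ (d' ⊠ y')).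
- by lin.
- by rewrite deltaM.1 algone_sw //; lin.
- move=> d y d' y'; rewrite deltaM.2 algM_sw; last by lin.
  rhs rewrite mul_swl.
  rhs rewrite mul_swr.
  by rhs rewrite !tens_mul.
by move=> m1 mM; split=> [|x y]; rewrite /coassr ?deltaM.1 ?deltaM.2.
Qed.

(** The coaction of C turns into the coproduct of C, and the two copies of R^-1
    agree by the two hexagon identities for R^-1. *)
Lemma coassA a : coassl (tA a) = coassr (tA a).
Proof.
rewrite /coassl /coassr deltaA /coactA.
rewrite sw_sw; last by lin.
rewrite [RHS]sw_sw; last by lin.
lhs rewrite sw_sw.
lhs rewrite sw_tens.
lhs rewrite dd_Delta_mul.
lhs rewrite dd_Delta_H.
lhs rewrite dd_Delta_C.
exch 1.
lhs rewrite Rinv_hexagonl.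
rhs rewrite sw_sw.
rhs rewrite sw_tens.
rhs rewrite deltaA.
do 2 rhs rewrite sw_sw.
rhs rewrite sw_tens.
rhs rewrite comod_coact_act.
symmetry.
exch 3. exch 2.
lhs rewrite comod_coassoc_sw.
exch 3. exch 2. exch 1.
lhs rewrite Rinv_hexagonr.
exch 3. exch 2. exch 1. exch 2. exch 3.
by lhs rewrite dH_mul -mulrA -comod_actM.
Qed.

(** This is the coassociativity of the coproduct of the double on B. *)
Lemma coassB b : coassl (tB b) = coassr (tB b).
Proof.
rewrite /coassl /coassr deltaB /coactB.
rewrite sw2_sw2; last by lin.
rewrite [RHS]sw2_sw2; last by lin.
lhs rewrite dd_Delta_mul.
lhs rewrite dd_Delta_B.
lhs rewrite dd_Delta_H.
rhs rewrite deltaB sw2_sw2.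
rhs rewrite br_Delta_act.
exch 3. exch 2.
lhs rewrite R_hexagonr.
exch 2. exch 1.
lhs rewrite (coassoc_sw (br_coalgebra B)).
exch 2. exch 3. exch 2.
rhs rewrite R_hexagonl.
symmetry; exch 2; exch 1; symmetry.
by lhs rewrite -mulrA -dH_mul br_actM.
Qed.

Lemma coassH h : coassl (tH h) = coassr (tH h).
Proof.
rewrite /coassl /coassr deltaH /coactH.
rewrite sw_sw; last by lin.
rewrite [RHS]sw_sw; last by lin.
lhs rewrite sw_tens.
lhs rewrite dd_Delta_H.
rhs rewrite sw_tens.
rhs rewrite deltaH sw_sw.
rhs rewrite sw_tens.
by lhs rewrite (coassoc_sw coH).
Qed.

Let counit x := \sw_(d, y <- delta x) dd_eps D d *: y.

Lemma counit_morphism : monoid_morphism counit.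
Proof.
have epsM := bialg_epsM (dd_bialgebra D).
have [] := @sw_monoid_morphism _ D P P (fun d y => dd_eps D d *: y).
- by lin.
- by rewrite epsM.1 scale1r.
- by move=> d y d' y'; rewrite epsM.2 alg_scaleAl alg_scaleAr scalerA.
by move=> m1 mM; split=> [|x y]; rewrite /counit ?deltaM.1 ?deltaM.2.
Qed.

Lemma coaction_comodule_algebra : is_comodule_algebra delta.
Proof.
split=> // x.
  have ll : linear coassl by rewrite /coassl; lin.
  have lr : linear coassr by rewrite /coassr; lin.
  pose fl : {linear P -> tensor D (tensor D P)} :=
    HB.pack coassl (GRing.isLinear.Build k P (tensor D (tensor D P)) *:%R coassl ll).
  pose fr : {linear P -> tensor D (tensor D P)} :=
    HB.pack coassr (GRing.isLinear.Build k P (tensor D (tensor D P)) *:%R coassr lr).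
  apply: (tp_morphism_eq (f := fl) (g := fr)).
  - exact: coassl_morphism.
  - exact: coassr_morphism.
  - exact: coassA.
  - exact: coassB.
  - exact: coassH.
have lc : linear counit by rewrite /counit; lin.
pose f : {linear P -> P} :=
  HB.pack counit (GRing.isLinear.Build k P P *:%R counit lc).
have epsM := bialg_epsM (dd_bialgebra D).
apply: (tp_morphism_eq (f := f) (g := idfun)) => [|||b|h] /=.
- exact: counit_morphism.
- by [].
- move=> a; rewrite /counit deltaA /coactA sw_sw; last by lin.
  lhs rewrite sw_sw.
  lhs rewrite sw_tens.
  lhs rewrite epsM.2 dd_epsH dd_epsC -scalerA.
  lhs rewrite -sw_scale.
  lhs rewrite (comod_counit_sw (F := fun x => tA (_ ▶ x))).
  by rewrite Rinv_epsl ?comod_act1 //; lin.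
- rewrite /counit deltaB /coactB sw2_sw2; last by lin.
  lhs rewrite epsM.2 dd_epsH dd_epsB -scalerA.
  lhs rewrite -sw_scale.
  lhs rewrite R_epsr.
  lhs rewrite br_act1.
  by rewrite (counitl_sw (br_coalgebra B)) //; lin.
- rewrite /counit deltaH /coactH sw_sw; last by lin.
  lhs rewrite sw_tens.
  lhs rewrite dd_epsH.
  by rewrite (counitl_sw coH) //; lin.
Qed.

Lemma closed_sw (V W : lmodType k) (X : nmodType) (Q : X -> Prop) (t : V ⊗ W) F :
  Q 0 -> (forall x y, Q x -> Q y -> Q (x + y)) -> (forall v w, Q (F v w)) ->
  Q (sweedler t F).
Proof. by move=> Q0 QD QF; rewrite /sweedler; elim/big_ind: _. Qed.

Lemma in_ABT a b : in_AB (tA a * tB b).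
Proof. by exists (a ⊠ b); rewrite sw_tens //; lin. Qed.

Lemma in_AB_0 : in_AB 0.
Proof. by have := in_ABT 0 0; rewrite !raddf0 mul0r. Qed.

Lemma in_AB_linear (x : k) (u v : P) :
  in_AB u -> in_AB v -> in_AB (x *: u + v).
Proof.
move=> [t ->] [t' ->]; exists (x *: t + t').
have lG : linear (fun t : A ⊗ B => \sw_(a, b <- t) tA a * tB b) by lin.
by rewrite lG.
Qed.

Lemma in_AB_sw (V W : lmodType k) (t : V ⊗ W) F :
  (forall v w, in_AB (F v w)) -> in_AB (sweedler t F).
Proof.
apply: closed_sw => [|x y Px Py]; last by rewrite -[x]scale1r; apply: in_AB_linear.
exact: in_AB_0.
Qed.

(** In a product (a b)(a' b') the relation for b a' keeps the order A, B. *)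
Lemma coaction_comodule_subalgebra :
  is_comodule_subalgebra delta (in_AB).
Proof.
split.
- exact: in_AB_linear.
- by rewrite -[1]mulr1 -{1}(tp_Amorph P).1 -(tp_Bmorph P).1; apply: in_ABT.
- move=> _ _ [t ->] [t' ->]; rewrite mul_swl; apply: in_AB_sw => a b.
  rewrite mul_swr; apply: in_AB_sw => a' b'.
  rewrite -mulrA (mulrA (tB b)) tp_BA mul_swl mul_swr; apply: in_AB_sw => r s.
  rewrite mul_swl mul_swr; apply: in_AB_sw => a0 c.
  rewrite mul_swl mul_swr; apply: in_AB_sw => b1 b2.
  rewrite alg_scaleAl alg_scaleAr -!mulrA -tB_mul mulrA -tA_mul -[_ *: _]addr0.
  apply: in_AB_linear; first exact: in_ABT.
  exact: in_AB_0.
move=> _ [t ->].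
pose good (z : D ⊗ P) := exists2 s : seq (D * P),
   (forall p, p \in s -> in_AB p.2) & z = \sum_(p <- s) p.1 ⊠ p.2.
have goodD z z' : good z -> good z' -> good (z + z').
  move=> [s sQ ->] [s' sQ' ->]; exists (s ++ s'); last by rewrite big_cat.
  by move=> p; rewrite mem_cat => /orP[/sQ|/sQ'].
have goodsw (V W : lmodType k) (u : V ⊗ W) F : (forall v w, good (F v w)) -> good (sweedler u F).
  by apply: closed_sw => //; exists [::]; rewrite ?big_nil.
rewrite -/(good _) bundled_sw; apply: (goodsw) => a b.
rewrite deltaM.2 deltaA deltaB mul_swl; apply: (goodsw) => p q.
rewrite mul_swl; apply: (goodsw) => a0 c.
rewrite mul_swr; apply: (goodsw) => b1 b2.
rewrite mul_swr; apply: (goodsw) => r s.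
rewrite tens_mul.
set d := _ * _ ; set y := _ * _.
exists [:: (d, y)]; last by rewrite big_seq1.
by move=> z; rewrite inE => /eqP -> /=; apply: in_ABT.
Qed.
End GivenCoaction.
End Coaction.

Theorem corollary3p17 (k : fieldType) (H : qtHopf k) (C B : brHopf H)
    (ev : weakDuality C B) (A : comodAlg C)
    (D : drinDouble ev) (P : tripleProduct ev A) :
  (is_left_module_in (induced_action ev (A := A)) /\
   forall (b : B) (a : A), tp_B P b * tp_A P a =
     \sw_(b1, b2 <- br_Delta B b)
       \sw_(x, y <- braiding (br_act B) (comod_act A) b2 a)
         tp_A P (induced_action ev b1 x) * tp_B P y) /\
  exists delta : {linear P -> D ⊗ P},
    [/\ is_comodule_algebra delta,
        is_comodule_subalgebra delta (@in_AB _ _ _ _ _ _ P)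
      & [/\ forall a : A, delta (tp_A P a) =
              \sw_(p, q <- qt_Rinv H) \sw_(a0, c <- comod_coact A a)
                (dd_H D p * dd_C D c) ⊠ tp_A P (q ▶ a0),
            forall b : B, delta (tp_B P b) =
              \sw_(b1, b2 <- br_Delta B b) \sw_(r, s <- qt_R H)
                (dd_B D b1 * dd_H D s) ⊠ tp_B P (r ▷ b2)
          & forall h : H, delta (tp_H P h) =
              \sw_(h1, h2 <- qt_Delta H h) dd_H D h1 ⊠ tp_H P h2]].
Proof.
split.
  split.
    split.
    - exact: induced_action_bilinear.
    - exact: induced_action_act.
    - exact: induced_action_1.
    - exact: induced_action_M.
  move=> b a; have lphi := induced_action_bilinear ev A.
  rewrite tp_BA.
  lhs rewrite br_Delta_act.
  exch 1.
  lhs rewrite R_hexagonl.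
  lhs rewrite comod_actM.
  exch 2. exch 1. exch 0. exch 1.
  lhs rewrite br_act_S.
  rhs rewrite /braiding sw_sw.
  rhs rewrite sw_tens.
  by rhs rewrite (@induced_action_sw _ _ _ _ _ _ _ (fun x => tp_A P x * _)).
have [delta [deltaM deltaA deltaB deltaH]] := coaction_exists D P.
exists delta; split.
- exact: coaction_comodule_algebra.
- exact: coaction_comodule_subalgebra.
- by split.
Qed.
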